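(* Let $M$ be a smooth manifold of dimension $n\ge 3$ with a complete Riemannian metric $g$, and let $(g,V_1,c_1)$ and $(g,V_2,c_2)$ be two distinct non-trivial Yamabe solitons on $M$ with the same metric $g$, i.e. $V_1,V_2$ are smooth vector fields and $c_1,c_2\in\mathbb{R}$ constants with $\mathcal{L}_{V_1}g = 2(R-c_1)g$ and $\mathcal{L}_{V_2}g=2(R-c_2)g$, where $R$ is the scalar curvature of $g$. Then the commutator $[V_1,V_2]$ is a Killing vector field of $g$, i.e. $\mathcal{L}_{[V_1,V_2]}g=0$.
   Context: A Yamabe soliton $(g,V,c)$ on a manifold $M^n$ consists of a complete Riemannian metric $g$, a smooth vector field $V$ (the soliton vector field) and a real constant $c$ (the soliton constant) satisfying $\mathcal{L}_V g_{ij} = 2(-c+R)g_{ij}$, where $\mathcal{L}_V$ is the Lie derivative along $V$ and $R$ is the scalar curvature of $g$. Two solitons with the same metric are distinct if $(V_1,c_1)\neq(V_2,c_2)$. A Yamabe soliton is non-trivial if its soliton vector field is not a Killing vector field. *)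

(* Defs.v *)
From HB Require Import structures.
From mathcomp Require Import all_boot all_order all_algebra.
From mathcomp Require Import all_classical all_reals all_analysis.
Set Implicit Arguments.
Unset Strict Implicit.
Unset Printing Implicit Defensive.
Import Order.TTheory GRing.Theory Num.Theory.
Import numFieldNormedType.Exports.
Local Open Scope classical_set_scope.
Local Open Scope ring_scope.

(* Riemannian geometry in classical tensor notation: a tensor field is a family
   of component functions, one for each chart of an atlas, obeying the
   transformation law under changes of coordinates.  Points of R^n are row
   vectors; only the values of components on the images of the charts are
   meaningful. *)

Section Calculus.
Context {R : realType} {n : nat}.

Definition partial (a : 'I_n) (f : 'rV[R]_n -> R) : 'rV[R]_n -> R :=
  fun x => 'D_(delta_mx 0 a) f x.

(* All partial derivatives of order at most k exist and are continuous on U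
   (U is meant to be open). *)
Fixpoint Ck_on (k : nat) (U : set 'rV[R]_n) (f : 'rV[R]_n -> R) : Prop :=
  (forall x, U x -> {for x, continuous f}) /\
  match k with
  | 0 => True
  | k'.+1 => forall a : 'I_n,
      (forall x, U x -> derivable f x (delta_mx 0 a)) /\
      Ck_on k' U (partial a f)
  end.

Definition smooth_on (U : set 'rV[R]_n) (f : 'rV[R]_n -> R) : Prop :=
  forall k, Ck_on k U f.

(* Row a, column b: derivative of the b-th component along the a-th coordinate;
   tangent row vectors are pushed forward by v |-> v *m jac f x. *)
Definition jac (f : 'rV[R]_n -> 'rV[R]_n) (x : 'rV[R]_n) : 'M[R]_n :=
  \matrix_(a, b) partial a (fun y => f y 0 b) x.

End Calculus.

(* A smooth n-dimensional structure on M.  The atlas need not be maximal, and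
   chart_at picks, for each point, a chart around it. *)
Record smooth_atlas (R : realType) (n : nat) (M : topologicalType) := SmoothAtlas {
  chart_index : Type;
  dom : chart_index -> set M;
  chart : chart_index -> M -> 'rV[R]_n;
  chart_inv : chart_index -> 'rV[R]_n -> M;
  chart_at : M -> chart_index;
  dom_chart_at : forall p, dom (chart_at p) p;
  open_dom : forall i, open (dom i);
  open_image : forall i, open (chart i @` dom i);
  chartK : forall i p, dom i p -> chart_inv i (chart i p) = p;
  chart_continuous : forall i p, dom i p -> {for p, continuous (chart i)};
  chart_inv_continuous : forall i x, (chart i @` dom i) x ->
    {for x, continuous (chart_inv i)};
  transition_smooth : forall i j (b : 'I_n),
    smooth_on (chart i @` (dom i `&` dom j))
              (fun x => chart j (chart_inv i x) 0 b)
}.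

Section Geometry.
Context {R : realType} {n : nat} {M : topologicalType}.
Variable A : smooth_atlas R n M.

Definition chart_image (i : chart_index A) : set 'rV[R]_n := chart i @` dom i.

Definition overlap (i j : chart_index A) : set 'rV[R]_n := chart i @` (dom i `&` dom j).

Definition transition (i j : chart_index A) (x : 'rV[R]_n) : 'rV[R]_n :=
  chart j (chart_inv i x).

(* V i x 0 a is the component V^a at the point of coordinates x in chart i. *)
Definition vector_components := chart_index A -> 'rV[R]_n -> 'rV[R]_n.

(* g i x a b is the component g_ab at the point of coordinates x in chart i. *)
Definition tensor_components := chart_index A -> 'rV[R]_n -> 'M[R]_n.

Definition smooth_vector_field (V : vector_components) : Prop :=
  (forall i (a : 'I_n), smooth_on (chart_image i) (fun x => V i x 0 a)) /\
  (forall i j x, overlap i j x ->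
     V j (transition i j x) = V i x *m jac (transition i j) x).

Definition eq_field (V W : vector_components) : Prop :=
  forall i x, chart_image i x -> V i x = W i x.

Definition riemannian_metric (g : tensor_components) : Prop :=
  [/\ (forall i (a b : 'I_n), smooth_on (chart_image i) (fun x => g i x a b)),
      (forall i x, chart_image i x -> (g i x)^T = g i x),
      (forall i x, chart_image i x -> forall v : 'rV[R]_n, v != 0 ->
         0 < (v *m g i x *m v^T) 0 0)
    & (forall i j x, overlap i j x ->
         g i x = jac (transition i j) x *m g j (transition i j x)
                   *m (jac (transition i j) x)^T)].

(* [V, W]^a = V^k d_k W^a - W^k d_k V^a *)
Definition lie_bracket (V W : vector_components) : vector_components :=
  fun i x => \row_a \sum_k
    (V i x 0 k * partial k (fun y => W i y 0 a) x -
     W i x 0 k * partial k (fun y => V i y 0 a) x).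

(* (L_V g)_ab = V^k d_k g_ab + g_kb d_a V^k + g_ak d_b V^k, that is,
   (L_V g)(X, Y) = V (g(X, Y)) - g([V, X], Y) - g(X, [V, Y])
   on coordinate fields. *)
Definition lie_derivative (V : vector_components) (g : tensor_components) :
    tensor_components :=
  fun i x => \matrix_(a, b) \sum_k
    (V i x 0 k * partial k (fun y => g i y a b) x +
     g i x k b * partial a (fun y => V i y 0 k) x +
     g i x a k * partial b (fun y => V i y 0 k) x).

(* Gamma^c_ab = 1/2 g^cl (d_a g_lb + d_b g_la - d_l g_ab) *)
Definition christoffel (g : tensor_components) (i : chart_index A) (c a b : 'I_n)
    (x : 'rV[R]_n) : R :=
  2^-1 * \sum_l invmx (g i x) c l *
    (partial a (fun y => g i y l b) x + partial b (fun y => g i y l a) x -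
     partial l (fun y => g i y a b) x).

(* R^d_cab, where R(d_a, d_b) d_c = R^d_cab d_d and
   R(X, Y) = [nabla_X, nabla_Y] - nabla_[X, Y] *)
Definition riemann (g : tensor_components) (i : chart_index A) (d c a b : 'I_n)
    (x : 'rV[R]_n) : R :=
  partial a (christoffel g i d b c) x - partial b (christoffel g i d a c) x +
  \sum_m (christoffel g i d a m x * christoffel g i m b c x -
          christoffel g i d b m x * christoffel g i m a c x).

Definition ricci (g : tensor_components) (i : chart_index A) (c b : 'I_n)
    (x : 'rV[R]_n) : R :=
  \sum_a riemann g i a c a b x.

Definition scalar_curvature (g : tensor_components) (i : chart_index A)
    (x : 'rV[R]_n) : R :=
  \sum_c \sum_b invmx (g i x) c b * ricci g i c b x.

Definition C1_curve_at (gamma : R -> M) (t : R) : Prop :=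
  {for t, continuous gamma} /\
  forall i : chart_index A, dom i (gamma t) ->
    derivable (chart i \o gamma) t 1 /\
    {for t, continuous (derive1 (chart i \o gamma))}.

(* C^1 on the closed interval [a, b], as the restriction of a curve that is C^1
   on a slightly larger open interval *)
Definition C1_curve_on (gamma : R -> M) (a b : R) : Prop :=
  exists2 e : R, 0 < e &
    forall t, a - e < t -> t < b + e -> C1_curve_at gamma t.

(* The g-norm of the velocity, which does not depend on the chart. *)
Definition speed (g : tensor_components) (gamma : R -> M) (t : R) : R :=
  let i := chart_at A (gamma t) in
  let v := derive1 (chart i \o gamma) t in
  Num.sqrt ((v *m g i (chart i (gamma t)) *m v^T) 0 0).

Definition curve_length (g : tensor_components) (gamma : R -> M) (a b : R) :
    \bar R :=
  (\int[lebesgue_measure]_(t in `[a, b]) (speed g gamma t)%:E)%E.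

(* joined g p q L: some piecewise C^1 curve from p to q has length L. *)
Inductive joined (g : tensor_components) (p : M) : M -> \bar R -> Prop :=
| joined_refl : joined g p p 0%E
| joined_step (L : \bar R) (gamma : R -> M) (a b : R) :
    a <= b -> C1_curve_on gamma a b -> joined g p (gamma a) L ->
    joined g p (gamma b) (L + curve_length g gamma a b)%E.

(* +oo between points that no curve joins *)
Definition riemannian_distance (g : tensor_components) (p q : M) : \bar R :=
  ereal_inf [set L | joined g p q L].

(* (M, d_g) is a complete metric space. *)
Definition complete_metric (g : tensor_components) : Prop :=
  forall u : nat -> M,
    (forall e : R, 0 < e -> exists N : nat, forall m k : nat,
       (N <= m)%N -> (N <= k)%N -> (riemannian_distance g (u m) (u k) < e%:E)%E) ->
    exists p : M, forall e : R, 0 < e -> exists N : nat, forall m : nat,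
       (N <= m)%N -> (riemannian_distance g (u m) p < e%:E)%E.

Definition killing_field (g : tensor_components) (V : vector_components) : Prop :=
  smooth_vector_field V /\
  forall i x, chart_image i x -> lie_derivative V g i x = 0.

Definition yamabe_soliton (g : tensor_components) (V : vector_components)
    (c : R) : Prop :=
  [/\ riemannian_metric g, complete_metric g, smooth_vector_field V
    & forall i x, chart_image i x ->
        lie_derivative V g i x = (2 * (scalar_curvature g i x - c)) *: g i x].

Definition nontrivial_soliton (g : tensor_components) (V : vector_components)
    (c : R) : Prop :=
  yamabe_soliton g V c /\ ~ killing_field g V.

Definition distinct_solitons (V1 V2 : vector_components) (c1 c2 : R) : Prop :=
  ~ (eq_field V1 V2 /\ c1 = c2).

End Geometry.

(* Main.v *)
Require Import Defs.
From mathcomp Require Import all_boot all_order all_algebra.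
From mathcomp Require Import all_classical all_reals all_analysis.
From mathcomp Require Import ring lra.
Set Implicit Arguments.
Unset Strict Implicit.
Unset Printing Implicit Defensive.
Import Order.TTheory GRing.Theory Num.Theory.
Import numFieldNormedType.Exports.
Local Open Scope classical_set_scope.
Local Open Scope ring_scope.

(* Put W = V1 - V2, so that L_W g = s g with s = 2 (c2 - c1).  If L_V1 g = f1 g and
   L_V2 g = f2 g, then L_[V1,V2] g = (V1 f2 - V2 f1) g, which for f_i = 2 (S - c_i), S being
   the scalar curvature, equals 2 (W S) g.  Curvature is natural, so W S = - s S, and it
   remains to show that S = 0 when s != 0.

   Flowing along W in the direction in which g contracts, the norm |W| decays exponentially
   and S^2 grows, while completeness makes the flow line converge to a zero of W; since
   W S = - s S, S vanishes there.  Ekeland's variational principle replaces the flow: if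
   S(p) != 0, then among the points q with S(q)^2 >= S(p)^2 there is one where |W| cannot be
   decreased, in proportion to the distance, without decreasing S^2.  As W S = - s S <> 0
   at q, W does not vanish there, and a short straight step along W in a chart is a
   contradiction. *)

(** * Partial derivatives and smooth functions *)

Section Partial.
Context {R : realType} {n : nat}.
Implicit Types (f g : 'rV[R]_n -> R) (x y z v : 'rV[R]_n) (a b : 'I_n).

Local Notation e_ a := (delta_mx 0 a : 'rV[R]_n).

(** Naturality of curvature is used infinitesimally: each of g, its first derivatives, the
    Christoffel symbols, the Riemann and Ricci tensors gets a law for its derivative along W in a
    fixed chart, with the second and third derivatives of W cancelling by symmetry of partial
    derivatives. A homothety leaves the connection and Ricci invariant, so the weight - s of S comes
    only from the inverse metric that contracts Ricci. The obstacle is that completeness speaks of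
    the Riemannian distance, while |W| and S are known to be continuous only in charts. A point near
    p in distance must therefore be shown to lie in a given chart near p. This is where the
    Hausdorff axiom enters: it lets a bump function supported in a chart be extended by zero. The
    distance is handled only through upper bounds, and each order of its two arguments is estimated
    separately, which explains the doubled conditions in the variational principle. That S does not
    depend on the chart is read off the soliton equation, as the conformal factor of a tensorial
    identity. For c1 = c2 the field W is Killing and W S = 0 is immediate; only the other case needs
    S = 0. *)

Lemma is_derive_lineP (W : normedModType R) (f : 'rV[R]_n -> W) z v (s : R) (d : W) :
  is_derive (s *: v + z) v f d <-> is_derive s 1 (fun t : R => f (t *: v + z)) d.
Proof.
have E : (fun h : R => h^-1 *: (((fun t : R => f (t *: v + z)) \o shift s) (h *: 1) -
         f (s *: v + z)))
       = (fun h : R => h^-1 *: ((f \o shift (s *: v + z)) (h *: v) - f (s *: v + z))).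
  apply/funext => h /=; congr (_ *: (f _ - _)).
  by rewrite [h *: 1]mulr1 scalerDl addrA.
split=> -[fv <-]; apply: DeriveDef.
- by rewrite /derivable E.
- by rewrite /derive E.
- by rewrite /derivable -E.
- by rewrite /derive -E.
Qed.

(** The intermediate point is located only by [|s| <= |d|], so that one statement serves steps of
    either sign. *)
Lemma MVT_line f z v (d : R) :
  (forall s : R, `|s| <= `|d| -> derivable f (s *: v + z) v) ->
  exists2 s, `|s| <= `|d| & f (d *: v + z) - f z = d * 'D_v f (s *: v + z).
Proof.
move=> fd.
have der (s : R) : `|s| <= `|d| -> is_derive s 1 (fun t : R => f (t *: v + z)) ('D_v f (s *: v + z)).
  by move=> sd; apply/is_derive_lineP/derivableP; exact: fd.
have cont (u w : R) : (forall s : R, u <= s <= w -> `|s| <= `|d|) ->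
    {within `[u, w], continuous (fun t : R => f (t *: v + z))}.
  move=> uw; apply: derivable_within_continuous => s; rewrite in_itv/= => /uw sd.
  by case: (der s sd).
have [d0|d0|d0] := ltgtP d 0.
- have dE s : d <= s <= 0 -> `|s| <= `|d|.
    by move=> /andP[ds s0]; rewrite !ler0_norm ?(ltW d0)// lerN2.
  have der' (s : R) : s \in `]d, 0[ ->
      is_derive s 1 (fun t : R => f (t *: v + z)) ('D_v f (s *: v + z)).
    by rewrite in_itv/= => /andP[ds s0]; apply: der; apply: dE; rewrite !ltW.
  have [s] := MVT d0 der' (cont _ _ dE).
  rewrite in_itv/= => /andP[ds s0] E; exists s; first by apply: dE; rewrite !ltW.
  by move: E; rewrite scale0r add0r sub0r => E; rewrite -opprB E; ring.
- have dE s : 0 <= s <= d -> `|s| <= `|d|.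
    by move=> /andP[ds s0]; rewrite !ger0_norm ?(ltW d0)//.
  have der' (s : R) : s \in `]0, d[ ->
      is_derive s 1 (fun t : R => f (t *: v + z)) ('D_v f (s *: v + z)).
    by rewrite in_itv/= => /andP[ds s0]; apply: der; apply: dE; rewrite !ltW.
  have [s] := MVT d0 der' (cont _ _ dE).
  rewrite in_itv/= => /andP[ds s0] E; exists s; first by apply: dE; rewrite !ltW.
  by move: E; rewrite scale0r add0r subr0 => ->; rewrite mulrC.
- by exists 0; rewrite ?normr0 // d0 !scale0r add0r subrr mul0r.
Qed.

Lemma ler_coord_norm x a : `|x 0 a| <= `|x|.
Proof.
rewrite [leRHS]/Num.Def.normr/= mx_normrE.
by apply: le_trans (le_bigmax _ _ (0, a)).
Qed.

Lemma norm_row_le x (r : R) : 0 <= r -> (forall a, `|x 0 a| <= r) -> `|x| <= r.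
Proof.
move=> r0 xr; rewrite [leLHS]/Num.Def.normr/= mx_normrE.
by apply: bigmax_le => // -[i a] _ /=; rewrite ord1.
Qed.

Lemma near_rowP x (P : set 'rV[R]_n) :
  (\forall y \near x, P y) <->
  exists2 e : R, 0 < e & forall y, `|y - x| < e -> P y.
Proof.
split=> [/nbhs_ballP[e /= e0 eP]|[e e0 eP]].
  by exists e => // y yx; apply: eP; rewrite -ball_normE /= distrC.
apply/nbhs_ballP; exists e => // y; rewrite -ball_normE /= distrC; exact: eP.
Qed.

Lemma cvg_rowP (q : 'rV[R]_n -> R) x (l : R) :
  q y @[y --> x] --> l <->
  forall eps : R, 0 < eps -> exists2 r : R, 0 < r &
    forall y, `|y - x| < r -> `|l - q y| <= eps.
Proof.
split=> [/(@cvgrPdist_le _ _ _ (nbhs x) _ q) H eps eps0|H].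
  by apply/near_rowP; exact: H.
apply/(@cvgrPdist_le _ _ _ (nbhs x) _ q) => eps eps0.
by apply/near_rowP; exact: H.
Qed.

(* Caratheodory form of differentiability: q is a difference quotient, continuous at x. *)
Lemma caratheodory_C1 f x :
  (forall a, \forall y \near x, derivable f y (e_ a)) ->
  (forall a, {for x, continuous (partial a f)}) ->
  exists2 q : 'I_n -> 'rV[R]_n -> R,
    (forall a, q a y @[y --> x] --> partial a f x) &
    forall y, f y - f x = \sum_a q a y * (y 0 a - x 0 a).
Proof.
move=> df cf.
(* A staircase from [x] to [y]: the first [k] coordinates are those of [y], the others those of [x].
   Consecutive vertices differ along one axis, and f y - f x telescopes over the edges. *)
pose z y (k : nat) : 'rV[R]_n := \row_j (if (j < k)%N then y 0 j else x 0 j).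
have zS y (a : 'I_n) : z y a.+1 = (y 0 a - x 0 a) *: e_ a + z y a.
  apply/rowP => j; rewrite !mxE eqxx /= ltnS leq_eqVlt.
  have [->|ja] := eqVneq j a; first by rewrite eqxx ltnn /=; ring.
  by rewrite eq_sym (_ : (a == j :> nat) = false) /= ?mulr0 ?add0r //;
    apply/negbTE; rewrite eq_sym.
(* On a degenerate edge the value is the intended limit. On the others the mean value theorem makes
   the quotient a partial derivative at a point no farther from [x] than [y]. *)
pose q a y := if y 0 a == x 0 a then partial a f x
              else (f (z y a.+1) - f (z y a)) / (y 0 a - x 0 a).
exists q => [a|y]; last first.
  transitivity (\sum_(a < n) (f (z y (nat_of_ord a).+1) - f (z y a))).
    rewrite -(big_mkord predT (fun k => f (z y k.+1) - f (z y k))) telescope_sumr //.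
    by congr (f _ - f _); apply/rowP => j; rewrite !mxE ?ltn_ord.
  apply: eq_bigr => a _; rewrite /q; case: eqP => [ya|/eqP ya].
    by rewrite zS ya subrr scale0r add0r subrr mulr0.
  by rewrite divfK // subr_eq0.
apply/cvg_rowP => eps eps0.
have /near_rowP[r1 r10 r1P] := df a.
have /cvg_rowP /(_ eps eps0)[r2 r20 r2P] := cf a.
exists (Num.min r1 r2) => [|y].
  by rewrite lt_min r10.
rewrite lt_min => /andP[yr1 yr2].
rewrite /q; case: eqP => [_|/eqP ya]; first by rewrite subrr normr0 ltW.
have close s : `|s| <= `|y 0 a - x 0 a| -> `|s *: e_ a + z y a - x| <= `|y - x|.
  move=> sa; apply: norm_row_le => // j; rewrite !mxE eqxx /=.
  have [->|ja] := eqVneq j a.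
    rewrite ltnn mulr1 addrK (le_trans sa)// (le_trans _ (ler_coord_norm _ a))//.
    by rewrite !mxE.
  rewrite mulr0 add0r; case: ifP => _; last by rewrite subrr normr0.
  by rewrite (le_trans _ (ler_coord_norm _ j))// !mxE.
have [s|s sa E] := @MVT_line f (z y a) (e_ a) (y 0 a - x 0 a).
  by move=> sa; apply: r1P; apply: le_lt_trans yr1; exact: close.
rewrite zS E mulrAC divff ?mul1r ?subr_eq0 //.
by apply: r2P; apply: le_lt_trans yr2; exact: close.
Qed.

(** The hypotheses give coordinate derivatives only, not a Frechet differential. Composing the
    quotients of [caratheodory_C1] with [c] writes the difference quotient of the composite as a
    finite sum of products of convergent factors. *)
Lemma is_derive_C1_curve f (c : R -> 'rV[R]_n) (t : R) (dc : 'rV[R]_n) :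
  (forall a, \forall y \near c t, derivable f y (e_ a)) ->
  (forall a, {for c t, continuous (partial a f)}) ->
  is_derive t 1 c dc ->
  is_derive t 1 (f \o c) (\sum_a dc 0 a * partial a f (c t)).
Proof.
move=> df cf dct.
have [q qc qE] := caratheodory_C1 df cf.
have cont : {for t, continuous c}.
  by apply: differentiable_continuous; apply/derivable1_diffP; exact: ex_derive.
have cvg_q a : q a (c (h *: 1 + t)) @[h --> 0^'] --> partial a f (c t).
  apply: (@cvg_comp _ _ _ (fun h : R => c (h *: 1 + t)) _ _ _ _ _ (qc a)).
  apply: (@cvg_comp _ _ _ (fun h : R => h *: 1 + t) _ _ _ _ _ cont).
  apply: cvg_within_filter.
  rewrite -[in X in _ --> X](add0r t); apply: cvgD; last exact: cvg_cst.
  under eq_fun do rewrite [_ *: 1]mulr1.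
  exact: cvg_id.
have cvg_c a : h^-1 * (c (h *: 1 + t) 0 a - c t 0 a) @[h --> 0^'] --> dc 0 a.
  have dca : derivable (fun s => c s 0 a) t 1 by apply: (derivable_mxP _ _ _).1; exact: ex_derive.
  have -> : dc 0 a = 'D_1 (fun s => c s 0 a) t.
    by rewrite -[dc]derive_val derive_mx ?mxE //; exact: ex_derive.
  exact: dca.
have main : h^-1 *: ((f \o c) (h *: 1 + t) - (f \o c) t) @[h --> 0^'] -->
   \sum_a dc 0 a * partial a f (c t).
  rewrite (_ : (fun h => _) = (fun h =>
      \sum_a (h^-1 * (c (h *: 1 + t) 0 a - c t 0 a)) * q a (c (h *: 1 + t)))).
    by apply: cvg_big => [|a _]; [exact: add_continuous|apply: cvgM]; [exact: cvg_c|exact: cvg_q].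
  apply/funext => h; rewrite /= qE scaler_sumr; apply: eq_bigr => a _.
  by rewrite /GRing.scale /=; ring.
apply: DeriveDef; first by apply/cvg_ex; eexists; exact: main.
exact: cvg_lim main.
Qed.

(* Both mixed derivatives are the limit of the same second difference quotient. *)
Lemma schwarz f x a b :
  (\forall y \near x, derivable f y (e_ a)) ->
  (\forall y \near x, derivable f y (e_ b)) ->
  (\forall y \near x, derivable (partial a f) y (e_ b)) ->
  (\forall y \near x, derivable (partial b f) y (e_ a)) ->
  {for x, continuous (partial b (partial a f))} ->
  {for x, continuous (partial a (partial b f))} ->
  partial a (partial b f) x = partial b (partial a f) x.
Proof.
move=> fa fb fab fba cab cba.
(* The second difference is symmetric in [a] and [b]: once it approximates one mixed derivative,
   exchanging the two indices makes it approximate the other. *)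
wlog suff main : a b fa fb fab fba cab cba /
  forall eps : R, 0 < eps -> exists2 r : R, 0 < r & forall h : R, 0 < h -> h < r ->
    `|partial b (partial a f) x -
      (f (h *: e_ a + (h *: e_ b + x)) - f (h *: e_ b + x)
         - (f (h *: e_ a + x) - f x)) / h / h| <= eps.
  apply/eqP; rewrite -subr_eq0 -normr_le0; apply/ler_addgt0Pr => eps eps0.
  have e20 : 0 < eps / 2 by rewrite divr_gt0.
  have [r1 r10 P1] := main _ _ fa fb fab fba cab cba _ e20.
  have [r2 r20 P2] := main _ _ fb fa fba fab cba cab _ e20.
  pose h := Num.min r1 r2 / 2.
  have h0 : 0 < h by rewrite divr_gt0 // lt_min r10.
  have hlt : h < Num.min r1 r2 by rewrite ltr_pdivrMr // ltr_pMr ?lt_min ?r10 // ltr1n.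
  move: hlt; rewrite lt_min => /andP[h1 h2].
  have := P1 h h0 h1; have := P2 h h0 h2.
  rewrite (_ : h *: e_ b + (h *: e_ a + x) = h *: e_ a + (h *: e_ b + x)); last first.
    by rewrite addrCA.
  rewrite opprB !addrA [f _ - f _ - _]addrAC.
  set u := partial b _ _; set w := partial a _ _; set q := _ / h / h => A B.
  have {B}: `|u - q| <= eps / 2.
    apply: le_trans B; rewrite le_eqVlt /q; apply/orP; left; apply/eqP.
    by congr (`|_ - _ / _ / _|); ring.
  rewrite add0r => B; apply: le_trans (ler_distD q w u) _.
  by clearbody u w q; rewrite distrC in B; lra.
move=> eps eps0.
have /near_rowP[r1 r10 r1P] := fa.
have /near_rowP[r2 r20 r2P] := fab.
have /cvg_rowP /(_ eps eps0)[r3 r30 r3P] := cab.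
pose r := Num.min r1 (Num.min r2 r3) / 2.
have r0 : 0 < r by rewrite divr_gt0 // !lt_min r10 r20 r30.
have e1 c : `|e_ c| <= 1.
  apply: norm_row_le => // j; rewrite mxE; case: (_ && _); rewrite ?normr0 ?normr1 //.
have close s u : `|s| < r -> `|u| < r ->
    `|s *: e_ a + (u *: e_ b + x) - x| < Num.min r1 (Num.min r2 r3).
  move=> sr ur; rewrite addrA addrK (le_lt_trans (ler_normD _ _)) // !normrZ.
  rewrite [ltRHS]splitr; apply: ltrD; [apply: le_lt_trans sr|apply: le_lt_trans ur]; exact: ler_piMr.
exists r => // h h0 hr.
have nh : `|h| = h by rewrite gtr0_norm.
(* The second difference is an increment of [F] along e_a. One mean value step for [F] along e_a and
   one for [partial a f] along e_b express it as h^2 times a mixed derivative at a nearby point. *)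
pose F y := f (h *: e_ b + y) - f y.
have dF s : `|s| <= `|h| -> derivable f (s *: e_ a + x) (e_ a) /\
    derivable f (s *: e_ a + (h *: e_ b + x)) (e_ a).
  rewrite nh => sh; split; apply: r1P.
    have := @close s 0 (le_lt_trans sh hr); rewrite normr0 scale0r add0r => /(_ r0).
    by rewrite !lt_min => /andP[].
  have := @close s h (le_lt_trans sh hr); rewrite nh => /(_ hr).
  by rewrite !lt_min => /andP[].
have dFs s : `|s| <= `|h| -> is_derive (s *: e_ a + x) (e_ a) F
   (partial a f (s *: e_ a + (h *: e_ b + x)) - partial a f (s *: e_ a + x)).
  move=> /dF[d1 d2].
  have E : (fun y => f (h *: e_ b + y)) = f \o shift (h *: e_ b) .
    by apply/funext => y /=; rewrite addrC.
  have Q : is_derive (s *: e_ a + x) (e_ a) (fun y => f (h *: e_ b + y))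
      (partial a f (s *: e_ a + (h *: e_ b + x))).
    have QE : (fun k : R => k^-1 *: (((fun y => f (h *: e_ b + y)) \o
          shift (s *: e_ a + x)) (k *: e_ a) - f (h *: e_ b + (s *: e_ a + x))))
      = (fun k => k^-1 *: ((f \o shift (s *: e_ a + (h *: e_ b + x))) (k *: e_ a) -
          f (s *: e_ a + (h *: e_ b + x)))).
      apply/funext => k /=; rewrite [h *: _ + (s *: _ + x)]addrCA; congr (_ *: (f _ - _)).
      by rewrite [LHS]addrCA; congr (_ + _); rewrite addrCA.
    apply: DeriveDef; first by rewrite /derivable QE.
    by rewrite /partial /derive QE.
  by apply: is_deriveB; apply: derivableP.
have [|s sh E] := @MVT_line F x (e_ a) h.
  by move=> s /dFs H; exact: ex_derive.
have := dFs s sh => /(@derive_val _ _ _ _ _ _ _) Es.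
have [|u uh E2] := @MVT_line (partial a f) (s *: e_ a + x) (e_ b) h.
  rewrite nh in sh *.
  move=> u uh; apply: r2P; rewrite addrCA; have := close s u (le_lt_trans sh hr) (le_lt_trans uh hr).
  by rewrite !lt_min => /and3P[].
have -> : f (h *: e_ a + (h *: e_ b + x)) - f (h *: e_ b + x) - (f (h *: e_ a + x) - f x) =
   h * (h * partial b (partial a f) (u *: e_ b + (s *: e_ a + x))).
  rewrite -E2 [h *: e_ b + (s *: _ + x)]addrCA -Es -E /F.
  by rewrite [h *: e_ b + (h *: e_ a + _)]addrCA; ring.
have -> w : h * (h * w) / h / h = w by field; rewrite gt_eqF.
apply: r3P; rewrite addrCA.
rewrite nh in sh uh; have := close s u (le_lt_trans sh hr) (le_lt_trans uh hr).
by rewrite !lt_min => /and3P[].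
Qed.

End Partial.

Lemma near_eq_continuous (T U : topologicalType) (f g : T -> U) (x : T) :
  {near x, f =1 g} -> {for x, continuous f} -> {for x, continuous g}.
Proof.
move=> fg; rewrite /prop_for /continuous_at (nbhs_singleton fg).
by move=> cf; apply: cvg_trans cf; exact: near_eq_cvg.
Qed.

Section SmoothOn.
Context {R : realType} {n : nat}.
Variables (U : set 'rV[R]_n) (openU : open U).
Implicit Types (f g : 'rV[R]_n -> R) (x : 'rV[R]_n) (a b : 'I_n) (k : nat).

Local Notation e_ a := (delta_mx 0 a : 'rV[R]_n).

Let nearU x : U x -> \forall y \near x, U y.
Proof. by move=> Ux; apply: open_nbhs_nbhs. Qed.

Lemma Ck_on_near k f x : Ck_on k.+1 U f -> U x ->
  forall a, \forall y \near x, derivable f y (e_ a).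
Proof.
move=> [_ Cf] Ux a; apply: filterS (nearU Ux) => y Uy.
exact: (Cf a).1.
Qed.

Lemma Ck_onW k f : Ck_on k.+1 U f -> Ck_on k U f.
Proof.
elim: k f => [|k IHk] f [cf df]; split=> // a.
by have [dfa Cfa] := df a; split=> //; apply: IHk.
Qed.

Lemma eq_partial_on f g a x : (forall y, U y -> f y = g y) -> U x ->
  partial a f x = partial a g x.
Proof.
move=> fg Ux; apply: near_eq_derive.
by apply: filterS (nearU Ux) => y /fg.
Qed.

Lemma eq_derivable_on f g a x : (forall y, U y -> f y = g y) -> U x ->
  derivable f x (e_ a) -> derivable g x (e_ a).
Proof.
move=> fg Ux; apply: near_eq_derivable.
by apply: filterS (nearU Ux) => y /fg.
Qed.

Lemma eq_Ck_on k f g : (forall x, U x -> f x = g x) -> Ck_on k U f -> Ck_on k U g.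
Proof.
elim: k f g => [|k IHk] f g fg [cf df]; split=> //;
  do ?by move=> x Ux; apply: near_eq_continuous (cf x Ux); apply: filterS (nearU Ux) => y /fg.
move=> a; have [dfa Cfa] := df a; split.
  by move=> x Ux; apply: eq_derivable_on (dfa x Ux).
by apply: IHk Cfa => x Ux; exact: eq_partial_on.
Qed.

Lemma Ck_on_cst k (c : R) : Ck_on k U (fun=> c).
Proof.
elim: k c => [|k IHk] c; split=> //; do ?by move=> x _; exact: cst_continuous.
move=> a; split; first by move=> x _; exact: derivable_cst.
rewrite (_ : partial a _ = fun=> 0); first exact: IHk.
by apply/funext => x; exact: derive_cst.
Qed.

Lemma Ck_onD k f g : Ck_on k U f -> Ck_on k U g -> Ck_on k U (fun x => f x + g x).
Proof.
elim: k f g => [|k IHk] f g [cf df] [cg dg]; split=> //;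
  do ?by move=> x Ux; apply: continuousD; [exact: cf|exact: cg].
move=> a; have [dfa Cfa] := df a; have [dga Cga] := dg a; split.
  by move=> x Ux; apply: derivableD; [exact: dfa|exact: dga].
apply: eq_Ck_on (IHk _ _ Cfa Cga) => x Ux; apply/esym.
by apply: deriveD; [exact: dfa|exact: dga].
Qed.

Lemma Ck_onM k f g : Ck_on k U f -> Ck_on k U g -> Ck_on k U (fun x => f x * g x).
Proof.
elim: k f g => [|k IHk] f g Cf Cg; have [cf df] := Cf; have [cg dg] := Cg; split=> //;
  do ?by move=> x Ux; apply: continuousM; [exact: cf|exact: cg].
move=> a; have [dfa Cfa] := df a; have [dga Cga] := dg a; split.
  by move=> x Ux; apply: derivableM; [exact: dfa|exact: dga].
apply: eq_Ck_on (Ck_onD (IHk _ _ (Ck_onW Cf) Cga) (IHk _ _ (Ck_onW Cg) Cfa)) => x Ux.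
by apply/esym; apply: deriveM; [exact: dfa|exact: dga].
Qed.

(** In the derivative - f^-1 f^-1 d_a f the inverse appears one order lower, where the induction
    already controls it. *)
Lemma Ck_onV k f : (forall x, U x -> f x != 0) -> Ck_on k U f ->
  Ck_on k U (fun x => (f x)^-1).
Proof.
move=> f0; elim: k => [|k IHk] Cf; have [cf df] := Cf; split=> //;
  do ?by move=> x Ux; apply: continuousV; [exact: f0|exact: cf].
move=> a; have [dfa Cfa] := df a; split.
  by move=> x Ux; apply: derivableV; [exact: f0|exact: dfa].
have CV := IHk (Ck_onW Cf).
apply: eq_Ck_on (Ck_onM (Ck_on_cst k (-1)) (Ck_onM (Ck_onM CV CV) Cfa)) => x Ux.
rewrite /partial deriveV; [|exact: f0|exact: dfa].
by rewrite expr2 invfM /GRing.scale /= mulN1r mulNr.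
Qed.

(** Removes the order [k]: derivatives of smooth functions are smooth again without loss, so they
    can be iterated freely. *)
Lemma smooth_onP f : smooth_on U f <->
  (forall x, U x -> {for x, continuous f}) /\
  (forall a, (forall x, U x -> derivable f x (e_ a)) /\ smooth_on U (partial a f)).
Proof.
split=> [sf|[cf df] [|k]]; [|split=> //|].
  split=> [|a]; first exact: (sf 0%N).1.
  by split=> [|k]; [exact: ((sf 1%N).2 a).1|exact: ((sf k.+1).2 a).2].
by split=> // a; have [? ?] := df a; split.
Qed.

Lemma smooth_continuous f x : smooth_on U f -> U x -> {for x, continuous f}.
Proof. by move=> /smooth_onP[cf _] Ux; exact: cf. Qed.

Lemma smooth_derivable f x a : smooth_on U f -> U x -> derivable f x (e_ a).
Proof. by move=> /smooth_onP[_ /(_ a)[df _]] Ux; exact: df. Qed.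

Lemma smooth_derivable_near f x a : smooth_on U f -> U x ->
  \forall y \near x, derivable f y (e_ a).
Proof. by move=> sf Ux; exact: (Ck_on_near (sf 1%N)). Qed.

Lemma smooth_partial f a : smooth_on U f -> smooth_on U (partial a f).
Proof. by move=> /smooth_onP[_ /(_ a)[_]]. Qed.

Lemma eq_smooth_on f g : (forall x, U x -> f x = g x) -> smooth_on U f -> smooth_on U g.
Proof. by move=> fg sf k; exact: eq_Ck_on (sf k). Qed.

Lemma smooth_cst (c : R) : smooth_on U (fun=> c).
Proof. by move=> k; exact: Ck_on_cst. Qed.

Lemma smoothD f g : smooth_on U f -> smooth_on U g -> smooth_on U (fun x => f x + g x).
Proof. by move=> sf sg k; apply: Ck_onD. Qed.

Lemma smoothM f g : smooth_on U f -> smooth_on U g -> smooth_on U (fun x => f x * g x).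
Proof. by move=> sf sg k; apply: Ck_onM. Qed.

Lemma smoothN f : smooth_on U f -> smooth_on U (fun x => - f x).
Proof.
move=> sf; apply: eq_smooth_on (smoothM (smooth_cst (-1)) sf) => x _.
by rewrite mulN1r.
Qed.

Lemma smoothB f g : smooth_on U f -> smooth_on U g -> smooth_on U (fun x => f x - g x).
Proof. by move=> sf sg; apply: smoothD => //; apply: smoothN. Qed.

Lemma smoothV f : (forall x, U x -> f x != 0) -> smooth_on U f ->
  smooth_on U (fun x => (f x)^-1).
Proof. by move=> f0 sf k; apply: Ck_onV. Qed.

Lemma smooth_sum (I : Type) (r : seq I) (P : pred I) (F : I -> 'rV[R]_n -> R) :
  (forall i, P i -> smooth_on U (F i)) ->
  smooth_on U (fun x => \sum_(i <- r | P i) F i x).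
Proof.
move=> sF; elim: r => [|i r IHr].
  by apply: eq_smooth_on (smooth_cst 0) => x _; rewrite big_nil.
case Pi : (P i).
  by apply: eq_smooth_on (smoothD (sF i Pi) IHr) => x _; rewrite big_cons Pi.
by apply: eq_smooth_on IHr => x _; rewrite big_cons Pi.
Qed.

Lemma smooth_prod (I : Type) (r : seq I) (P : pred I) (F : I -> 'rV[R]_n -> R) :
  (forall i, P i -> smooth_on U (F i)) ->
  smooth_on U (fun x => \prod_(i <- r | P i) F i x).
Proof.
move=> sF; elim: r => [|i r IHr].
  by apply: eq_smooth_on (smooth_cst 1) => x _; rewrite big_nil.
case Pi : (P i).
  by apply: eq_smooth_on (smoothM (sF i Pi) IHr) => x _; rewrite big_cons Pi.
by apply: eq_smooth_on IHr => x _; rewrite big_cons Pi.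
Qed.

Lemma smooth_schwarz f x a b : smooth_on U f -> U x ->
  partial a (partial b f) x = partial b (partial a f) x.
Proof.
move=> sf Ux; have sa := smooth_partial a sf; have sb := smooth_partial b sf.
apply: schwarz; do ?exact: smooth_derivable_near.
- exact: smooth_continuous (smooth_partial _ sa) Ux.
- exact: smooth_continuous (smooth_partial _ sb) Ux.
Qed.

Lemma smooth_is_derive_comp f (c : R -> 'rV[R]_n) (t : R) (dc : 'rV[R]_n) :
  smooth_on U f -> U (c t) -> is_derive t 1 c dc ->
  is_derive t 1 (f \o c) (\sum_a dc 0 a * partial a f (c t)).
Proof.
move=> sf Uct; apply: is_derive_C1_curve => a.
  exact: smooth_derivable_near.
exact: smooth_continuous (smooth_partial a sf) Uct.
Qed.

End SmoothOn.

(** * Calculus of matrix fields *)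

Section MatrixCalculus.
Context {R : realType} {n : nat}.
Implicit Types (x : 'rV[R]_n) (a b : 'I_n) (V W : 'rV[R]_n -> 'rV[R]_n).

Local Notation e_ a := (delta_mx 0 a : 'rV[R]_n).

Definition mxderivable p q (F : 'rV[R]_n -> 'M[R]_(p, q)) x :=
  forall a i j, derivable (fun y => F y i j) x (e_ a).

Definition pmx p q a (F : 'rV[R]_n -> 'M[R]_(p, q)) x : 'M[R]_(p, q) :=
  \matrix_(i, j) partial a (fun y => F y i j) x.

Lemma pmxE p q a (F : 'rV[R]_n -> 'M[R]_(p, q)) x i j :
  pmx a F x i j = partial a (fun y => F y i j) x.
Proof. by rewrite mxE. Qed.

Lemma jacE V x a b : jac V x a b = partial a (fun y => V y 0 b) x.
Proof. by rewrite mxE. Qed.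

Definition dirmx p q V (F : 'rV[R]_n -> 'M[R]_(p, q)) x : 'M[R]_(p, q) :=
  \sum_k V x 0 k *: pmx k F x.

Definition dir V (f : 'rV[R]_n -> R) x : R := \sum_k V x 0 k * partial k f x.

Lemma dirmxE p q V (F : 'rV[R]_n -> 'M[R]_(p, q)) x i j :
  dirmx V F x i j = dir V (fun y => F y i j) x.
Proof. by rewrite summxE; apply: eq_bigr => k _; rewrite !mxE. Qed.

Lemma partialE a (f : 'rV[R]_n -> R) x : partial a f x = 'D_(e_ a) f x.
Proof. by []. Qed.

Lemma partialD a (f g : 'rV[R]_n -> R) x :
  derivable f x (e_ a) -> derivable g x (e_ a) ->
  partial a (fun y => f y + g y) x = partial a f x + partial a g x.
Proof. exact: deriveD. Qed.

Lemma partialB a (f g : 'rV[R]_n -> R) x :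
  derivable f x (e_ a) -> derivable g x (e_ a) ->
  partial a (fun y => f y - g y) x = partial a f x - partial a g x.
Proof. exact: deriveB. Qed.

Lemma partialN a (f : 'rV[R]_n -> R) x : derivable f x (e_ a) ->
  partial a (fun y => - f y) x = - partial a f x.
Proof. exact: deriveN. Qed.

Lemma partial_cst a (c : R) x : partial a (fun=> c) x = 0.
Proof. exact: derive_cst. Qed.

Lemma partialM a (f g : 'rV[R]_n -> R) x :
  derivable f x (e_ a) -> derivable g x (e_ a) ->
  partial a (fun y => f y * g y) x = partial a f x * g x + f x * partial a g x.
Proof.
move=> df dg; rewrite [LHS](deriveM df dg) [LHS]addrC; congr (_ + _).
exact: mulrC.
Qed.

Lemma dir_combination V (c : R) (f g h : 'rV[R]_n -> R) x :
  (forall k, derivable f x (e_ k)) -> (forall k, derivable g x (e_ k)) ->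
  (forall k, derivable h x (e_ k)) ->
  dir V (fun y => c * (f y + g y - h y)) x = c * (dir V f x + dir V g x - dir V h x).
Proof.
move=> df dg dh; rewrite /dir -big_split /= -sumrB mulr_sumr.
apply: eq_bigr => k _; have dfg := derivableD (df k) (dg k).
rewrite (partialM (derivable_cst _ _ _) (derivableB dfg (dh k))) partial_cst.
rewrite (partialB dfg (dh k)) (partialD (df k) (dg k)) mul0r add0r.
by rewrite mulrCA; congr (c * _); rewrite mulrBr mulrDr.
Qed.

Lemma derivable_suml (I : Type) (r : seq I) (F : I -> 'rV[R]_n -> R) x v :
  (forall i, derivable (F i) x v) -> derivable (fun y => \sum_(i <- r) F i y) x v.
Proof.
move=> dF; elim: r => [|i r IHr].
  by under eq_fun do rewrite big_nil; exact: derivable_cst.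
by under eq_fun do rewrite big_cons; apply: derivableD.
Qed.

Lemma partial_sum (I : Type) (r : seq I) (F : I -> 'rV[R]_n -> R) x a :
  (forall i, derivable (F i) x (e_ a)) ->
  partial a (fun y => \sum_(i <- r) F i y) x = \sum_(i <- r) partial a (F i) x.
Proof.
move=> dF; elim: r => [|i r IHr].
  by rewrite /partial; under eq_fun do rewrite big_nil; rewrite derive_cst big_nil.
under eq_fun do rewrite big_cons.
by rewrite partialD ?IHr ?big_cons //; exact: derivable_suml.
Qed.

Lemma dir_sum (I : Type) (r : seq I) V (F : I -> 'rV[R]_n -> R) x :
  (forall i a, derivable (F i) x (e_ a)) ->
  dir V (fun y => \sum_(i <- r) F i y) x = \sum_(i <- r) dir V (F i) x.
Proof.
move=> dF; rewrite /dir exchange_big; apply: eq_bigr => k _.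
by rewrite partial_sum ?mulr_sumr.
Qed.

Lemma mxderivableM p q r (F : 'rV[R]_n -> 'M[R]_(p, q)) (G : 'rV[R]_n -> 'M[R]_(q, r)) x :
  mxderivable F x -> mxderivable G x -> mxderivable (fun y => F y *m G y) x.
Proof.
move=> dF dG a i j; under eq_fun do rewrite mxE.
by apply: derivable_suml => k; apply: derivableM; [exact: dF|exact: dG].
Qed.

Lemma mxderivableT p q (F : 'rV[R]_n -> 'M[R]_(p, q)) x :
  mxderivable F x -> mxderivable (fun y => (F y)^T) x.
Proof. by move=> dF a i j; under eq_fun do rewrite mxE; exact: dF. Qed.

Lemma mxderivableD p q (F G : 'rV[R]_n -> 'M[R]_(p, q)) x :
  mxderivable F x -> mxderivable G x -> mxderivable (fun y => F y + G y) x.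
Proof.
move=> dF dG a i j; under eq_fun do rewrite mxE.
by apply: derivableD; [exact: dF|exact: dG].
Qed.

Lemma mxderivableZ p q (c : 'rV[R]_n -> R) (F : 'rV[R]_n -> 'M[R]_(p, q)) x :
  (forall a, derivable c x (e_ a)) -> mxderivable F x ->
  mxderivable (fun y => c y *: F y) x.
Proof.
move=> dc dF a i j; under eq_fun do rewrite mxE.
by apply: derivableM; [exact: dc|exact: dF].
Qed.

Lemma pmxM p q r a (F : 'rV[R]_n -> 'M[R]_(p, q)) (G : 'rV[R]_n -> 'M[R]_(q, r)) x :
  mxderivable F x -> mxderivable G x ->
  pmx a (fun y => F y *m G y) x = pmx a F x *m G x + F x *m pmx a G x.
Proof.
move=> dF dG; apply/matrixP => i j; rewrite !mxE -big_split /=.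
under eq_fun do rewrite mxE.
rewrite partial_sum => [|k]; last by apply: derivableM; [exact: dF|exact: dG].
apply: eq_bigr => k _; rewrite partialM; [|exact: dF|exact: dG].
by rewrite !mxE.
Qed.

Lemma pmxD p q a (F G : 'rV[R]_n -> 'M[R]_(p, q)) x :
  mxderivable F x -> mxderivable G x ->
  pmx a (fun y => F y + G y) x = pmx a F x + pmx a G x.
Proof.
move=> dF dG; apply/matrixP => i j; rewrite !mxE.
under eq_fun do rewrite mxE.
by rewrite partialD; [|exact: dF|exact: dG].
Qed.

Lemma pmxZ p q a (c : 'rV[R]_n -> R) (F : 'rV[R]_n -> 'M[R]_(p, q)) x :
  (forall a, derivable c x (e_ a)) -> mxderivable F x ->
  pmx a (fun y => c y *: F y) x = partial a c x *: F x + c x *: pmx a F x.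
Proof.
move=> dc dF; apply/matrixP => i j; rewrite !mxE.
under eq_fun do rewrite mxE.
by rewrite partialM; [|exact: dc|exact: dF].
Qed.

Lemma pmxT p q a (F : 'rV[R]_n -> 'M[R]_(p, q)) x :
  pmx a (fun y => (F y)^T) x = (pmx a F x)^T.
Proof. by apply/matrixP => i j; rewrite !mxE; under eq_fun do rewrite mxE. Qed.

Lemma pmx_cst p q a (c : 'M[R]_(p, q)) x : pmx a (fun=> c) x = 0.
Proof. by apply/matrixP => i j; rewrite !mxE; exact: derive_cst. Qed.

Lemma mxderivable_sum (I : Type) (r : seq I) p q (F : I -> 'rV[R]_n -> 'M[R]_(p, q)) x :
  (forall i, mxderivable (F i) x) -> mxderivable (fun y => \sum_(i <- r) F i y) x.
Proof.
move=> dF a i j; under eq_fun do rewrite summxE.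
by apply: derivable_suml => k; exact: dF.
Qed.

Lemma pmx_sum (I : Type) (r : seq I) p q a (F : I -> 'rV[R]_n -> 'M[R]_(p, q)) x :
  (forall i, mxderivable (F i) x) ->
  pmx a (fun y => \sum_(i <- r) F i y) x = \sum_(i <- r) pmx a (F i) x.
Proof.
move=> dF; apply/matrixP => i j; rewrite !mxE summxE.
under eq_fun do rewrite summxE.
rewrite partial_sum => [|k]; last exact: dF.
by apply: eq_bigr => k _; rewrite mxE.
Qed.

Lemma dirmxM p q r V (F : 'rV[R]_n -> 'M[R]_(p, q)) (G : 'rV[R]_n -> 'M[R]_(q, r)) x :
  mxderivable F x -> mxderivable G x ->
  dirmx V (fun y => F y *m G y) x = dirmx V F x *m G x + F x *m dirmx V G x.
Proof.
move=> dF dG; rewrite /dirmx mulmx_suml mulmx_sumr -big_split /=.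
apply: eq_bigr => k _; rewrite pmxM // scalerDr scalemxAl scalemxAr.
by rewrite -scalemxAr.
Qed.

Lemma dirmxD p q V (F G : 'rV[R]_n -> 'M[R]_(p, q)) x :
  mxderivable F x -> mxderivable G x ->
  dirmx V (fun y => F y + G y) x = dirmx V F x + dirmx V G x.
Proof.
move=> dF dG; rewrite /dirmx -big_split /=.
by apply: eq_bigr => k _; rewrite pmxD // scalerDr.
Qed.

Lemma dirmxZ p q V (c : 'rV[R]_n -> R) (F : 'rV[R]_n -> 'M[R]_(p, q)) x :
  (forall a, derivable c x (e_ a)) -> mxderivable F x ->
  dirmx V (fun y => c y *: F y) x = dir V c x *: F x + c x *: dirmx V F x.
Proof.
move=> dc dF; rewrite /dirmx /dir scaler_suml scaler_sumr -big_split /=.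
by apply: eq_bigr => k _; rewrite pmxZ // scalerDr !scalerA [c x * _]mulrC.
Qed.

Lemma pmxB p q a (F G : 'rV[R]_n -> 'M[R]_(p, q)) x :
  mxderivable F x -> mxderivable G x ->
  pmx a (fun y => F y - G y) x = pmx a F x - pmx a G x.
Proof.
move=> dF dG; apply/matrixP => i j; rewrite !mxE.
under eq_fun do rewrite !mxE.
by apply: partialB; [exact: dF|exact: dG].
Qed.

Lemma pmxN p q a (F : 'rV[R]_n -> 'M[R]_(p, q)) x :
  mxderivable F x -> pmx a (fun y => - F y) x = - pmx a F x.
Proof.
move=> dF; apply/matrixP => i j; rewrite !mxE.
under eq_fun do rewrite mxE.
by apply: partialN; exact: dF.
Qed.

Lemma mxderivableB p q (F G : 'rV[R]_n -> 'M[R]_(p, q)) x :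
  mxderivable F x -> mxderivable G x -> mxderivable (fun y => F y - G y) x.
Proof.
move=> dF dG a i j; under eq_fun do rewrite !mxE.
by apply: derivableB; [exact: dF|exact: dG].
Qed.

Lemma dirmxB p q V (F G : 'rV[R]_n -> 'M[R]_(p, q)) x :
  mxderivable F x -> mxderivable G x ->
  dirmx V (fun y => F y - G y) x = dirmx V F x - dirmx V G x.
Proof.
move=> dF dG; rewrite /dirmx -sumrB; apply: eq_bigr => k _.
by rewrite pmxB // scalerBr.
Qed.

Lemma dirmx_sum (I : Type) (r : seq I) p q V (F : I -> 'rV[R]_n -> 'M[R]_(p, q)) x :
  (forall i, mxderivable (F i) x) ->
  dirmx V (fun y => \sum_(i <- r) F i y) x = \sum_(i <- r) dirmx V (F i) x.
Proof.
move=> dF; rewrite /dirmx exchange_big; apply: eq_bigr => k _.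
by rewrite pmx_sum // scaler_sumr.
Qed.

Lemma dirmxT p q V (F : 'rV[R]_n -> 'M[R]_(p, q)) x :
  dirmx V (fun y => (F y)^T) x = (dirmx V F x)^T.
Proof.
rewrite /dirmx linear_sum /=; apply: eq_bigr => k _.
by rewrite pmxT linearZ.
Qed.

Lemma dirmx_cst p q V (c : 'M[R]_(p, q)) x : dirmx V (fun=> c) x = 0.
Proof. by rewrite /dirmx big1 // => k _; rewrite pmx_cst scaler0. Qed.

Section OnOpen.
Variables (U : set 'rV[R]_n) (openU : open U).

Definition smooth_mx p q (F : 'rV[R]_n -> 'M[R]_(p, q)) :=
  forall i j, smooth_on U (fun x => F x i j).

Lemma smooth_mxderivable p q (F : 'rV[R]_n -> 'M[R]_(p, q)) x :
  smooth_mx F -> U x -> mxderivable F x.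
Proof. by move=> sF Ux a i j; exact: smooth_derivable (sF i j) Ux. Qed.

Lemma smooth_mxM p q r (F : 'rV[R]_n -> 'M[R]_(p, q)) (G : 'rV[R]_n -> 'M[R]_(q, r)) :
  smooth_mx F -> smooth_mx G -> smooth_mx (fun y => F y *m G y).
Proof.
move=> sF sG i j; under eq_fun do rewrite mxE.
by apply: smooth_sum => // k _; apply: smoothM.
Qed.

Lemma smooth_mxD p q (F G : 'rV[R]_n -> 'M[R]_(p, q)) :
  smooth_mx F -> smooth_mx G -> smooth_mx (fun y => F y + G y).
Proof. by move=> sF sG i j; under eq_fun do rewrite mxE; apply: smoothD. Qed.

Lemma smooth_mxB p q (F G : 'rV[R]_n -> 'M[R]_(p, q)) :
  smooth_mx F -> smooth_mx G -> smooth_mx (fun y => F y - G y).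
Proof.
by move=> sF sG i j; under eq_fun do rewrite !mxE; apply: smoothB.
Qed.

Lemma smooth_mxZ p q (c : 'rV[R]_n -> R) (F : 'rV[R]_n -> 'M[R]_(p, q)) :
  smooth_on U c -> smooth_mx F -> smooth_mx (fun y => c y *: F y).
Proof. by move=> sc sF i j; under eq_fun do rewrite mxE; apply: smoothM. Qed.

Lemma smooth_mxT p q (F : 'rV[R]_n -> 'M[R]_(p, q)) :
  smooth_mx F -> smooth_mx (fun y => (F y)^T).
Proof. by move=> sF i j; under eq_fun do rewrite mxE; exact: sF. Qed.

Lemma smooth_pmx p q a (F : 'rV[R]_n -> 'M[R]_(p, q)) :
  smooth_mx F -> smooth_mx (pmx a F).
Proof. by move=> sF i j; under eq_fun do rewrite mxE; apply: smooth_partial. Qed.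

Lemma smooth_jac V : smooth_mx V -> smooth_mx (jac V).
Proof. by move=> sV a b; under eq_fun do rewrite mxE; apply: smooth_partial. Qed.

Lemma smooth_det p (F : 'rV[R]_n -> 'M[R]_p) : smooth_mx F ->
  smooth_on U (fun x => \det (F x)).
Proof.
move=> sF; apply: smooth_sum => // s _; apply: smoothM => //; first exact: smooth_cst.
exact: smooth_prod.
Qed.

Lemma smooth_invmx p (F : 'rV[R]_n -> 'M[R]_p) : smooth_mx F ->
  (forall x, U x -> F x \in unitmx) -> smooth_mx (fun x => invmx (F x)).
Proof.
move=> sF uF i j.
have s : smooth_on U (fun x => (\det (F x))^-1 * cofactor (F x) j i).
  apply: smoothM => //.
    apply: smoothV => // [x Ux|]; last exact: smooth_det.
    by have := uF x Ux; rewrite unitmxE unitfE.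
  apply: smoothM => //; first exact: smooth_cst.
  by apply: smooth_det => k l; under eq_fun do rewrite !mxE; exact: sF.
by apply: eq_smooth_on s => // x Ux; rewrite /invmx uF // !mxE.
Qed.

Lemma eq_pmx p q a (F G : 'rV[R]_n -> 'M[R]_(p, q)) x :
  (forall y, U y -> F y = G y) -> U x -> pmx a F x = pmx a G x.
Proof.
move=> FG Ux; apply/matrixP => i j; rewrite !mxE.
by apply: (eq_partial_on openU) => // y /FG ->.
Qed.

Lemma eq_dirmx p q V (F G : 'rV[R]_n -> 'M[R]_(p, q)) x :
  (forall y, U y -> F y = G y) -> U x -> dirmx V F x = dirmx V G x.
Proof.
by move=> FG Ux; apply: eq_bigr => k _; rewrite (eq_pmx _ FG).
Qed.

Lemma eq_jac V W x :
  (forall y, U y -> V y = W y) -> U x -> jac V x = jac W x.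
Proof.
move=> VW Ux; apply/matrixP => i j; rewrite !mxE.
by apply: (eq_partial_on openU) => // y /VW ->.
Qed.

Lemma pmx_comm p q a b (F : 'rV[R]_n -> 'M[R]_(p, q)) x :
  smooth_mx F -> U x -> pmx a (pmx b F) x = pmx b (pmx a F) x.
Proof.
have E c i j : (fun y => pmx c F y i j) = partial c (fun y => F y i j).
  by apply/funext => y; rewrite mxE.
move=> sF Ux; apply/matrixP => i j; rewrite [LHS]mxE [RHS]mxE !E.
exact: (smooth_schwarz openU).
Qed.

End OnOpen.
End MatrixCalculus.

Local Opaque partial.

(** Non-commutative identities are reduced to commutative ones: after distributing and
    reassociating, every remaining matrix product becomes an opaque matrix, and the identity is
    linear in the entries of these. *)
Ltac mx_entries :=
  repeat match goal with |- context [?A *m ?B] =>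
    let m := fresh "m" in set m := (A *m B); clearbody m end;
  rewrite ?mxE; ring.

Ltac mx_ring :=
  rewrite ?(mulmxDl, mulmxDr, mulmxBl, mulmxBr, mulNmx, mulmxN)
    -?(scalemxAl, scalemxAr) ?mulmxA;
  apply/matrixP => ? ?; mx_entries.

(** * Lie derivatives and curvature in one chart *)

Section LocalGeometry.
Context {R : realType} {n : nat}.
Variables (U : set 'rV[R]_n) (openU : open U).
Implicit Types (x : 'rV[R]_n) (V W : 'rV[R]_n -> 'rV[R]_n)
  (g : 'rV[R]_n -> 'M[R]_n).

(** Tangent vectors being rows, [jac V] has entries d_a V^k, so the two products are g_kb d_a V^k
    and g_ak d_b V^k. *)
Definition lie V g x : 'M[R]_n :=
  dirmx V g x + jac V x *m g x + g x *m (jac V x)^T.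

Definition bracket V W x : 'rV[R]_n := V x *m jac W x - W x *m jac V x.

Lemma pmx_jac V x k a b : pmx k (jac V) x a b = partial k (partial a (fun y => V y 0 b)) x.
Proof.
rewrite mxE; congr partial; apply/funext => y; by rewrite mxE.
Qed.

Lemma jac_mul V (F : 'rV[R]_n -> 'M[R]_n) x : mxderivable V x -> mxderivable F x ->
  jac (fun y => V y *m F y) x = jac V x *m F x + \matrix_a (V x *m pmx a F x).
Proof.
move=> dV dF; apply/matrixP => a b; rewrite !mxE -big_split /=.
under eq_fun do rewrite mxE.
rewrite partial_sum => [|k]; last by apply: derivableM; [exact: dV|exact: dF].
apply: eq_bigr => k _; rewrite partialM; [|exact: dV|exact: dF].
by rewrite !mxE.
Qed.

Lemma jacB V W x : mxderivable V x -> mxderivable W x ->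
  jac (fun y => V y - W y) x = jac V x - jac W x.
Proof.
move=> dV dW; apply/matrixP => a b; rewrite !mxE.
under eq_fun do rewrite !mxE.
by apply: partialB; [exact: dV|exact: dW].
Qed.

(* The entries of V d_a(jac W) are V^k d_a d_k W^b, so Schwarz' theorem makes this a
   derivative of jac W along V. *)
Lemma jac_mul_jac V W x : smooth_mx U V -> smooth_mx U W -> U x ->
  jac (fun y => V y *m jac W y) x = jac V x *m jac W x + dirmx V (jac W) x.
Proof.
move=> sV sW Ux; rewrite jac_mul; last first.
- exact: smooth_mxderivable (smooth_jac sW) Ux.
- exact: smooth_mxderivable sV Ux.
congr (_ + _); apply/matrixP => a b; rewrite dirmxE [LHS]mxE [LHS]mxE.
apply: eq_bigr => k _; congr (_ * _); rewrite pmx_jac.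
rewrite (_ : (fun y => jac W y a b) = partial a (fun y => W y 0 b)).
  exact: (smooth_schwarz openU).
by apply/funext => y; rewrite mxE.
Qed.

Lemma jac_bracket V W x : smooth_mx U V -> smooth_mx U W -> U x ->
  jac (bracket V W) x = jac V x *m jac W x - jac W x *m jac V x +
    dirmx V (jac W) x - dirmx W (jac V) x.
Proof.
move=> sV sW Ux.
have d V' W' : smooth_mx U V' -> smooth_mx U W' -> mxderivable (fun y => V' y *m jac W' y) x.
  move=> sV' sW'; apply: smooth_mxderivable Ux; apply: (smooth_mxM openU) => //.
  exact: smooth_jac.
rewrite /bracket jacB ?jac_mul_jac; try exact: d; try by [].
by rewrite opprD addrACA !addrA.
Qed.

Lemma smooth_bracket V W : smooth_mx U V -> smooth_mx U W ->
  smooth_mx U (bracket V W).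
Proof.
by move=> sV sW; apply: (smooth_mxB openU);
  apply: (smooth_mxM openU) => //; exact: smooth_jac.
Qed.

Lemma dirmx_dirmx p q V W (F : 'rV[R]_n -> 'M[R]_(p, q)) x :
  smooth_mx U W -> smooth_mx U F -> U x ->
  dirmx V (dirmx W F) x =
    \sum_b (V x *m jac W x) 0 b *: pmx b F x +
    \sum_b \sum_a (V x 0 a * W x 0 b) *: pmx a (pmx b F) x.
Proof.
move=> sW sF Ux.
have dpF b : mxderivable (pmx b F) x by apply: smooth_mxderivable Ux; exact: smooth_pmx.
have dW b a : derivable (fun y => W y 0 b) x (delta_mx 0 a).
  exact: smooth_derivable (sW 0 b) Ux.
rewrite [LHS]dirmx_sum => [|b]; last exact: mxderivableZ.
rewrite -big_split /=; apply: eq_bigr => b _; rewrite dirmxZ //; congr (_ *: _ + _).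
  by rewrite mxE; apply: eq_bigr => a _; rewrite mxE.
by rewrite scaler_sumr; apply: eq_bigr => a _; rewrite scalerA mulrC.
Qed.

(** The Hessian parts of V W F and W V F agree by symmetry of second derivatives; what survives is
    the first-order part, whose coefficients are those of the bracket. *)
Lemma dirmx_bracket p q V W (F : 'rV[R]_n -> 'M[R]_(p, q)) x :
  smooth_mx U V -> smooth_mx U W -> smooth_mx U F -> U x ->
  dirmx (bracket V W) F x = dirmx V (dirmx W F) x - dirmx W (dirmx V F) x.
Proof.
move=> sV sW sF Ux; rewrite !dirmx_dirmx // opprD addrACA -sumrB.
rewrite [X in _ + (X - _)]exchange_big /=.
set s := (X in _ + X); have -> : s = 0.
  apply/eqP; rewrite subr_eq0; apply/eqP.
  apply: eq_bigr => a _; apply: eq_bigr => b _.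
  by rewrite (pmx_comm openU) // mulrC.
rewrite addr0; apply: eq_bigr => b _; rewrite -scalerBl; congr (_ *: _).
by rewrite !mxE.
Qed.

(** This is L_[V,W] = [L_V, L_W] applied to g: L_V (s g) = (V s) g + s r g, and the symmetric term r
    s g drops out of the commutator. Instead of iterating Lie derivatives, the equations are solved
    for the plain directional derivatives of g and substituted. *)
Lemma lie_bracket_conformal V W g (r s : 'rV[R]_n -> R) x :
  smooth_mx U V -> smooth_mx U W -> smooth_mx U g ->
  smooth_on U r -> smooth_on U s ->
  (forall y, U y -> lie V g y = r y *: g y) ->
  (forall y, U y -> lie W g y = s y *: g y) ->
  U x -> lie (bracket V W) g x = (dir V s x - dir W r x) *: g x.
Proof.
move=> sV sW sg sr ss.
have dirE V' r' : (forall y, U y -> lie V' g y = r' y *: g y) -> forall y, U y ->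
    dirmx V' g y = r' y *: g y - jac V' y *m g y - g y *m (jac V' y)^T.
  by move=> LV y Uy; rewrite -LV // /lie [_ + _ + _ - _]addrAC !addrK.
move=> /dirE DV /dirE DW Ux.
(* Differentiates along V' the formula for the derivative of g along W', which holds on all of
   [U]. *)
have DD V' W' r' : smooth_mx U V' -> smooth_mx U W' -> smooth_on U r' ->
    (forall y, U y -> dirmx W' g y = r' y *: g y - jac W' y *m g y - g y *m (jac W' y)^T) ->
  dirmx V' (dirmx W' g) x = dir V' r' x *: g x + r' x *: dirmx V' g x -
    (dirmx V' (jac W') x *m g x + jac W' x *m dirmx V' g x) -
    (dirmx V' g x *m (jac W' x)^T + g x *m (dirmx V' (jac W') x)^T).
  move=> sV' sW' sr' E.
  have dg : mxderivable g x by exact: smooth_mxderivable sg Ux.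
  have dj : mxderivable (jac W') x by exact: smooth_mxderivable (smooth_jac sW') Ux.
  have dr a : derivable r' x (delta_mx 0 a) by exact: smooth_derivable sr' Ux.
  have djT := mxderivableT dj.
  rewrite (eq_dirmx openU _ E Ux) dirmxB; last first.
  - exact: mxderivableM.
  - by apply: mxderivableB; [exact: mxderivableZ|exact: mxderivableM].
  rewrite dirmxB; last first.
  - exact: mxderivableM.
  - exact: mxderivableZ.
  by rewrite dirmxZ // !dirmxM // dirmxT.
rewrite /lie jac_bracket // dirmx_bracket // (DD V W s) // (DD W V r) // DV // DW //.
move: (jac V x) (jac W x) (g x) (dirmx V _ x) (dirmx W _ x) (dir V s x) (dir W r x) (r x) (s x).
move=> A B G A' B' a b c d.
have trB (C D : 'M[R]_n) : (C - D)^T = C^T - D^T by exact: raddfB.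
have trD (C D : 'M[R]_n) : (C + D)^T = C^T + D^T by exact: raddfD.
rewrite !(trB, trD) !trmx_mul.
mx_ring.
Qed.

End LocalGeometry.

(* The Christoffel symbols of the first kind F are built from the array p of first
   derivatives of the metric by the same alternation as from D. *)
Lemma christoffel_alternation (R : realType) n (p D b2 : 'I_n -> 'I_n -> 'I_n -> R)
    (B G : 'I_n -> 'I_n -> R) (s : R) (F : 'I_n -> 'I_n -> 'I_n -> R) a b l :
  (forall c i j, p c i j = p c j i) ->
  (forall i j, G i j = G j i) ->
  (forall c i j, b2 c i j = b2 i c j) ->
  (forall c i j, F c i j = 2^-1 * (p c j i + p i j c - p j c i)) ->
  (forall c i j, D c i j = s * p c i j -
    \sum_k (b2 c i k * G k j + B i k * p c k j + p c i k * B j k + G i k * b2 c j k +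
            B c k * p k i j)) ->
  2^-1 * (D a l b + D b l a - D l a b) = s * F a b l -
    \sum_k (B a k * F k b l + B b k * F a k l + F a b k * B l k + b2 a b k * G k l).
Proof.
move=> pS GS bS FE DE; rewrite FE !DE.
set S1 := \sum_k _; set S2 := \sum_k _; set S3 := \sum_k _; set S := \sum_k _.
suff -> : S = 2^-1 * (S1 + S2 - S3) by ring.
rewrite /S /S1 /S2 /S3 -big_split /= -sumrB mulr_sumr.
apply: eq_bigr => k _; rewrite !FE.
rewrite (bS b a) (bS l a) (bS l b) (pS k l b) (pS k l a) (pS a k b) (pS b k a).
rewrite (GS k a) (GS k b) (GS k l).
by field.
Qed.

(** The index [a] is contracted with the upper index of the curvature. The [B]-terms acting on these
    two indices cancel after exchanging the sums, leaving the law of a covariant 2-tensor with zero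
    Lie derivative. *)
Lemma ricci_contraction (R : realType) n (F : 'I_n -> 'I_n -> 'M[R]_n)
    (Ric B : 'M[R]_n) c b :
  (forall p q, Ric p q = \sum_a F a q p a) ->
  \sum_a (- (\sum_k B a k *: F k b) - (\sum_k B b k *: F a k) -
     B *m F a b + F a b *m B) c a =
  (- (B *m Ric) - Ric *m B^T) c b.
Proof.
move=> RicE.
transitivity (\sum_a (- (\sum_k B a k * F k b c a)
   - (\sum_k B b k * F a k c a) - (\sum_k B c k * F a b k a)
   + \sum_k F a b c k * B k a)).
  apply: eq_bigr => a _; rewrite [LHS]mxE; congr (_ + _); last by rewrite mxE.
  rewrite [LHS]mxE; congr (_ + _); last by rewrite 2!mxE.
  rewrite [LHS]mxE; congr (_ + _).
    by rewrite mxE summxE; congr (- _); apply: eq_bigr => k _; rewrite mxE.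
  by rewrite mxE summxE; congr (- _); apply: eq_bigr => k _; rewrite mxE.
rewrite big_split /= !sumrB sumrN.
have -> : \sum_a \sum_k F a b c k * B k a = \sum_a \sum_k B a k * F k b c a.
  by rewrite exchange_big; apply: eq_bigr => a _; apply: eq_bigr => k _; rewrite mulrC.
have -> : \sum_a \sum_k B b k * F a k c a = (Ric *m B^T) c b.
  rewrite mxE exchange_big; apply: eq_bigr => k _; rewrite mxE RicE mulrC mulr_sumr.
  by [].
have -> : \sum_a \sum_k B c k * F a b k a = (B *m Ric) c b.
  by rewrite mxE exchange_big; apply: eq_bigr => k _; rewrite RicE mulr_sumr.
by rewrite !mxE; ring.
Qed.

Local Opaque pmx jac.

(** * Naturality of curvature under a homothetic field, in one chart *)

Section Curvature.
Context {R : realType} {n : nat}.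
Variables (U : set 'rV[R]_n) (openU : open U).
Implicit Types (x : 'rV[R]_n) (a b c : 'I_n).

(* For C a x b c = Gamma^c_ab, curvature C a b x c d = R^d_cab; tangent vectors being
   rows, the order of the products is reversed. *)
Definition curvature (C : 'I_n -> 'rV[R]_n -> 'M[R]_n) a b x : 'M[R]_n :=
  pmx a (C b) x - pmx b (C a) x + (C b x *m C a x - C a x *m C b x).

Section Definitions.
Variable g : 'rV[R]_n -> 'M[R]_n.

(* first_kind a x b l = g_lc Gamma^c_ab *)
Definition first_kind a x : 'M[R]_n :=
  2^-1 *: \matrix_(b, l) (pmx a g x l b + pmx b g x l a - pmx l g x a b).

(* connection a x b c = Gamma^c_ab *)
Definition connection a x : 'M[R]_n := first_kind a x *m invmx (g x).

Definition ricci_mx x : 'M[R]_n := \matrix_(c, b) \sum_a curvature connection a b x c a.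

(** The transpose turns the trace into the double sum of g^cb R_cb, with the index order of
    [scalar_curvature]. *)
Definition scal x : R := \tr (invmx (g x) *m (ricci_mx x)^T).

End Definitions.

Lemma smooth_curvature (C : 'I_n -> 'rV[R]_n -> 'M[R]_n) a b :
  (forall c, smooth_mx U (C c)) -> smooth_mx U (curvature C a b).
Proof.
move=> sC; apply: (smooth_mxD openU); apply: (smooth_mxB openU);
  by [exact: smooth_pmx|exact: smooth_mxM].
Qed.

Variables (W : 'rV[R]_n -> 'rV[R]_n) (sW : smooth_mx U W).
Local Notation B := (jac W).
Let sB : smooth_mx U B. Proof. exact: smooth_jac. Qed.

(** Moving d_a past W^k d_k leaves the commutator (d_a W^k) d_k, the source of the sums with
    coefficients [B x a k] in the laws for differentiated objects. *)
Lemma pmx_dirmx p q a (F : 'rV[R]_n -> 'M[R]_(p, q)) x : smooth_mx U F -> U x ->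
  pmx a (dirmx W F) x = \sum_k B x a k *: pmx k F x + dirmx W (pmx a F) x.
Proof.
move=> sF Ux.
have dF k : mxderivable (pmx k F) x by apply: smooth_mxderivable Ux; exact: smooth_pmx.
have dW k b : derivable (fun y => W y 0 k) x (delta_mx 0 b).
  exact: smooth_derivable (sW 0 k) Ux.
rewrite pmx_sum => [|k]; last exact: mxderivableZ.
rewrite -big_split /=; apply: eq_bigr => k _.
rewrite [LHS](pmxZ _ (dW k) (dF k)) [pmx a _ x](pmx_comm openU) //.
by congr (_ + _); congr (_ *: _); rewrite [RHS]jacE.
Qed.

Lemma pmx_jac_sym x a b c : U x -> pmx a B x b c = pmx b B x a c.
Proof. by move=> Ux; rewrite [LHS]pmx_jac [RHS]pmx_jac; exact: (smooth_schwarz openU). Qed.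

(** The hypothesis on [C] says that W preserves the connection, the last term d_c B being the
    inhomogeneous part of the Lie derivative of Christoffel symbols; the conclusion says that W
    preserves its curvature tensor. The third derivatives of W cancel by antisymmetry in a, b, and
    the products of d B with [C] cancel between the differentiated and the quadratic part of the
    curvature. *)
Lemma dirmx_curvature (C : 'I_n -> 'rV[R]_n -> 'M[R]_n) a b x :
  (forall c, smooth_mx U (C c)) ->
  (forall c y, U y -> dirmx W (C c) y = - (\sum_k B y c k *: C k y) -
     B y *m C c y + C c y *m B y - pmx c B y) ->
  U x ->
  dirmx W (curvature C a b) x =
    - (\sum_k B x a k *: curvature C k b x) - (\sum_k B x b k *: curvature C a k x) -
    B x *m curvature C a b x + curvature C a b x *m B x.
Proof.
move=> sC DC Ux.
have dC c : mxderivable (C c) x by exact: smooth_mxderivable (sC c) Ux.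
have dB : mxderivable B x by exact: smooth_mxderivable sB Ux.
have dpC c d : mxderivable (pmx c (C d)) x.
  exact: smooth_mxderivable (smooth_pmx c (sC d)) Ux.
pose S c d := \sum_k B x c k *: pmx d (C k) x.
pose T c d := \sum_k B x c k *: pmx k (C d) x.
pose Q c := \sum_k B x c k *: C k x.
have dpmxC c d : dirmx W (pmx c (C d)) x =
    - (\sum_k pmx c B x d k *: C k x) - S d c -
    (pmx c B x *m C d x + B x *m pmx c (C d) x) +
    (pmx c (C d) x *m B x + C d x *m pmx c B x) - pmx c (pmx d B) x - T c d.
  have -> : dirmx W (pmx c (C d)) x = pmx c (dirmx W (C d)) x - T c d.
    by rewrite (pmx_dirmx c (sC d) Ux) addrC addKr.
  congr (_ - _); rewrite (eq_pmx openU c (DC d) Ux).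
  have dZ k : mxderivable (fun y => B y d k *: C k y) x.
    by apply: mxderivableZ (dC k) => e; exact: dB.
  have dS := mxderivable_sum dZ.
  have dN : mxderivable (fun y => - \sum_k B y d k *: C k y) x.
    by move=> e i j; under eq_fun do rewrite mxE; apply: derivableN; exact: dS.
  have dBC := mxderivableM dB (dC d); have dCB := mxderivableM (dC d) dB.
  have dpB : mxderivable (pmx d B) x by exact: smooth_mxderivable (smooth_pmx d sB) Ux.
  rewrite (pmxB _ (mxderivableD (mxderivableB dN dBC) dCB) dpB).
  rewrite (pmxD _ (mxderivableB dN dBC) dCB) (pmxB _ dN dBC).
  rewrite (pmxM _ dB (dC d)) (pmxM _ (dC d) dB); congr (_ - _ + _ - _).
  rewrite (pmxN _ (dS _)) (pmx_sum _ _ dZ) -opprD; congr (- _); rewrite /S -big_split /=.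
  apply: eq_bigr => k _; rewrite (pmxZ _ _ (dC k)) => [|e]; last exact: dB.
  by rewrite [pmx c B x d k]pmxE.
rewrite dirmxD; last first.
- exact: mxderivableB (mxderivableM (dC b) (dC a)) (mxderivableM (dC a) (dC b)).
- exact: mxderivableB (dpC a b) (dpC b a).
rewrite (dirmxB _ (dpC a b) (dpC b a)).
rewrite (dirmxB _ (mxderivableM (dC b) (dC a)) (mxderivableM (dC a) (dC b))).
rewrite (dirmxM _ (dC b) (dC a)) (dirmxM _ (dC a) (dC b)) !dpmxC.
rewrite (DC a x Ux) (DC b x Ux).
(* The coefficients are second derivatives of W, symmetric in a and b, so the two sums of this kind
   are equal and disappear from the antisymmetrized expression. *)
pose P := \sum_k pmx a B x b k *: C k x.
have -> : \sum_k pmx b B x a k *: C k x = P.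
  by apply: eq_bigr => k _; congr (_ *: _); exact: pmx_jac_sym.
rewrite (pmx_comm openU b a sB Ux).
have -> : \sum_k B x a k *: curvature C k b x = T a b - S a b + (C b x *m Q a - Q a *m C b x).
  rewrite /T /S /Q mulmx_sumr mulmx_suml -!sumrB -big_split /=.
  by apply: eq_bigr => k _; rewrite -scalemxAr -scalemxAl -!scalerBr -scalerDr.
have -> : \sum_k B x b k *: curvature C a k x = S b a - T b a + (Q b *m C a x - C a x *m Q b).
  rewrite /T /S /Q mulmx_sumr mulmx_suml -!sumrB -big_split /=.
  by apply: eq_bigr => k _; rewrite -scalemxAr -scalemxAl -!scalerBr -scalerDr.
rewrite -/(Q a) -/(Q b) -/P /curvature.
move: P (pmx a (pmx b B) x) (pmx a B x) (pmx b B x) (pmx a (C b) x) (pmx b (C a) x).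
move: (S b a) (S a b) (T a b) (T b a) (Q a) (Q b) (C a x) (C b x) (B x).
move=> Sba Sab Tab Tba Qa Qb Ca Cb B0 X Y Ba Bb aCb bCa.
mx_ring.
Qed.

Variables (g : 'rV[R]_n -> 'M[R]_n) (sg : smooth_mx U g).
Hypothesis g_sym : forall x, U x -> (g x)^T = g x.
Hypothesis g_unit : forall x, U x -> g x \in unitmx.

Lemma smooth_first_kind a : smooth_mx U (first_kind g a).
Proof.
apply: (smooth_mxZ openU) => [|b l]; first exact: smooth_cst.
under eq_fun do rewrite mxE.
apply: smoothB => //; last exact: (smooth_pmx l sg).
by apply: smoothD => //; apply: smooth_pmx sg _ _.
Qed.

Lemma smooth_connection a : smooth_mx U (connection g a).
Proof.
apply: (smooth_mxM openU); first exact: smooth_first_kind.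
exact: smooth_invmx.
Qed.

Lemma smooth_ricci : smooth_mx U (ricci_mx g).
Proof.
move=> c b; under eq_fun do rewrite mxE.
by apply: smooth_sum => // a _; apply: smooth_curvature => d; exact: smooth_connection.
Qed.

Lemma smooth_scal : smooth_on U (scal g).
Proof.
apply: smooth_sum => // i _; apply: (smooth_mxM openU); first exact: smooth_invmx.
by apply: smooth_mxT; exact: smooth_ricci.
Qed.

Variable s : R.
Hypothesis lie_g : forall x, U x -> lie W g x = s *: g x.

Let Dg x : U x -> dirmx W g x = s *: g x - B x *m g x - g x *m (B x)^T.
Proof. by move=> Ux; rewrite -lie_g // /lie [_ + _ + _ - _]addrAC !addrK. Qed.

(** Obtained by differentiating g g^-1 = 1 along W; it expresses L_W g^-1 = - s g^-1. *)
Lemma dirmx_invmx x : U x ->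
  dirmx W (fun y => invmx (g y)) x =
    - s *: invmx (g x) + invmx (g x) *m B x + (B x)^T *m invmx (g x).
Proof.
move=> Ux; set h := fun y => invmx (g y).
have sh : smooth_mx U h by exact: smooth_invmx.
have /eqP : dirmx W (fun y => g y *m h y) x = 0.
  rewrite -(dirmx_cst W (1%:M : 'M[R]_n) x); apply: (eq_dirmx openU) => // y Uy.
  by rewrite mulmxV // g_unit.
rewrite dirmxM; [|exact: smooth_mxderivable Ux..].
rewrite addrC addr_eq0 => /eqP E.
have := congr1 (fun X => h x *m X) E; rewrite mulmxA mulVmx ?g_unit // mul1mx => ->.
rewrite Dg // mulmxN !mulmxBl !mulmxBr -!scalemxAl -!scalemxAr.
rewrite !mulmxA mulVmx ?g_unit // mul1mx -!mulmxA mulmxV ?g_unit // !mulmx1.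
rewrite mul1mx !opprB scaleNr -/(h x) [RHS]addrC [_ + h x *m _]addrC.
by [].
Qed.

Lemma dirmx_pmx_metric a x : U x ->
  dirmx W (pmx a g) x = s *: pmx a g x -
    (pmx a B x *m g x + B x *m pmx a g x) -
    (pmx a g x *m (B x)^T + g x *m (pmx a B x)^T) - \sum_k B x a k *: pmx k g x.
Proof.
move=> Ux; have sD := smooth_mxM openU.
have E := pmx_dirmx a sg Ux.
have -> : dirmx W (pmx a g) x = pmx a (dirmx W g) x - \sum_k B x a k *: pmx k g x.
  by rewrite E addrC addKr.
congr (_ - _); rewrite (eq_pmx openU a Dg Ux).
have dg : mxderivable g x := smooth_mxderivable sg Ux.
have dB : mxderivable B x := smooth_mxderivable sB Ux.
have ds b : derivable (fun=> s) x (delta_mx 0 b) by exact: derivable_cst.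
have dBT := mxderivableT dB.
rewrite pmxB; [|apply: mxderivableB; [exact: mxderivableZ|exact: mxderivableM]|exact: mxderivableM].
rewrite pmxB; [|exact: mxderivableZ|exact: mxderivableM].
rewrite (pmxM _ dB dg) (pmxM _ dg dBT) pmxT (pmxZ _ ds dg).
by rewrite partial_cst scale0r add0r.
Qed.

Lemma pmx_sym a x b c : U x -> pmx a g x b c = pmx a g x c b.
Proof.
move=> Ux; rewrite [LHS]pmxE [RHS]pmxE; apply: (eq_partial_on openU) => // y Uy.
by rewrite -[in LHS]g_sym // mxE.
Qed.

(** The symbols of the first kind scale by [s] like g itself, up to the second derivatives of W
    lowered by g. Since [s] is constant, no derivative of it appears. *)
Lemma dirmx_first_kind a x : U x ->
  dirmx W (first_kind g a) x = s *: first_kind g a x -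
    \sum_k B x a k *: first_kind g k x - B x *m first_kind g a x -
    first_kind g a x *m (B x)^T - pmx a B x *m g x.
Proof.
move=> Ux.
have gE b c : g x b c = g x c b by rewrite -[in LHS]g_sym // mxE.
have H c p q : dirmx W (pmx c g) x p q = s * pmx c g x p q -
    \sum_k (pmx c B x p k * g x k q + B x p k * pmx c g x k q +
            pmx c g x p k * B x q k + g x p k * pmx c B x q k + B x c k * pmx k g x p q).
  rewrite dirmx_pmx_metric // !big_split /=.
  have -> : \sum_k B x c k * pmx k g x p q = (\sum_k B x c k *: pmx k g x) p q.
    by rewrite summxE; apply: eq_bigr => k _; rewrite [RHS]mxE.
  move: (pmx c B x) (pmx c g x) (g x) (B x) (\sum_k _) => B' g' G B0 S.
  have trE (X Y : 'M[R]_n) : \sum_k X p k * Y q k = (X *m Y^T) p q.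
    by rewrite [RHS]mxE; apply: eq_bigr => k _; rewrite mxE.
  rewrite !trE.
  have mE (X Y : 'M[R]_n) : \sum_k X p k * Y k q = (X *m Y) p q.
    by rewrite [RHS]mxE.
  rewrite !mE.
  by mx_entries.
have fkE c p q : first_kind g c x p q = 2^-1 * (pmx c g x q p + pmx p g x q c - pmx q g x c p).
  by rewrite [LHS]mxE [in LHS]mxE.
apply/matrixP => b l.
have -> : dirmx W (first_kind g a) x b l = 2^-1 * (dirmx W (pmx a g) x l b +
    dirmx W (pmx b g) x l a - dirmx W (pmx l g) x a b).
  rewrite [LHS]dirmxE.
  have -> : (fun y => first_kind g a y b l) =
      (fun y => 2^-1 * (pmx a g y l b + pmx b g y l a - pmx l g y a b)).
    by apply/funext => y; rewrite [LHS]mxE [in LHS]mxE.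
  have d c p q k : derivable (fun y => pmx c g y p q) x (delta_mx 0 k).
    exact: (smooth_mxderivable (smooth_pmx c sg) Ux).
  rewrite dir_combination; try exact: d.
  by congr (_ * (_ + _ - _)); apply/esym; exact: dirmxE.
rewrite (@christoffel_alternation _ _ (fun c => pmx c g x) (fun c => dirmx W (pmx c g) x)
  (fun c => pmx c B x) (B x) (g x) s (fun c => first_kind g c x)) //; last first.
- by move=> c p q; exact: pmx_jac_sym.
- by move=> c p q; exact: pmx_sym.
rewrite !big_split /=.
have -> : \sum_k B x a k * first_kind g k x b l = (\sum_k B x a k *: first_kind g k x) b l.
  by rewrite summxE; apply: eq_bigr => k _; rewrite [RHS]mxE.
move: (pmx a B x) (g x) (B x) (\sum_k _) (first_kind g a x) => B' G B0 S C.
have trE (X Y : 'M[R]_n) : \sum_k X b k * Y l k = (X *m Y^T) b l.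
  by rewrite [RHS]mxE; apply: eq_bigr => k _; rewrite mxE.
rewrite !trE.
have mE (X Y : 'M[R]_n) : \sum_k X b k * Y k l = (X *m Y) b l.
  by rewrite [RHS]mxE.
rewrite !mE.
by mx_entries.
Qed.

(** The factor [s] of the first-kind symbols cancels against the - s of the inverse metric: a
    homothetic field preserves the Levi-Civita connection. This is the hypothesis that
    [dirmx_curvature] asks for. *)
Lemma dirmx_connection a x : U x ->
  dirmx W (connection g a) x =
    - (\sum_k B x a k *: connection g k x) - B x *m connection g a x +
    connection g a x *m B x - pmx a B x.
Proof.
move=> Ux; rewrite dirmxM; last first.
- by apply: smooth_mxderivable Ux; exact: smooth_invmx.
- by apply: smooth_mxderivable Ux; exact: smooth_first_kind.
rewrite dirmx_first_kind // dirmx_invmx //.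
have -> : \sum_k B x a k *: connection g k x = (\sum_k B x a k *: first_kind g k x) *m invmx (g x).
  by rewrite mulmx_suml; apply: eq_bigr => k _; rewrite scalemxAl.
rewrite /connection.
have gV := mulmxV (g_unit Ux).
move: (pmx a B x) (g x) (invmx (g x)) gV (B x) (\sum_k _) (first_kind g a x) => B' G H GH B0 S C.
rewrite -[B' in RHS]mulmx1 -GH.
mx_ring.
Qed.

(** This is L_W Ric = 0, the contraction of the invariance of the curvature tensor. *)
Lemma dirmx_ricci x : U x ->
  dirmx W (ricci_mx g) x = - (B x *m ricci_mx g x) - ricci_mx g x *m (B x)^T.
Proof.
move=> Ux; apply/matrixP => c b; pose K a := curvature (connection g) a b.
have E : dirmx W (ricci_mx g) x c b = \sum_a dirmx W (K a) x c a.
  rewrite [LHS]dirmxE.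
  have -> : (fun y => ricci_mx g y c b) = (fun y => \sum_a K a y c a).
    by apply/funext => y; rewrite [LHS]mxE.
  rewrite dir_sum => [|a e]; first by apply: eq_bigr => a _; rewrite [RHS]dirmxE.
  by apply: (smooth_mxderivable (smooth_curvature _ _ _) Ux); exact: smooth_connection.
have DK a := dirmx_curvature a b smooth_connection dirmx_connection Ux.
rewrite E (eq_bigr _ (fun a _ => congr1 (fun M : 'M[R]_n => M c a) (DK a))) /K.
have ricE p q : ricci_mx g x p q = \sum_a curvature (connection g) a q x p a.
  by rewrite [LHS]mxE.
exact: (@ricci_contraction _ _ (fun a b => curvature (connection g) a b x) _ _ _ _ ricE).
Qed.

(** Ricci being invariant, the whole weight comes from g^-1; the terms in [B] cancel by cyclicity of
    the trace. *)
Lemma dir_scal x : U x -> dir W (scal g) x = - s * scal g x.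
Proof.
move=> Ux; have sH : smooth_mx U (fun y => invmx (g y)) by exact: smooth_invmx.
have dH := smooth_mxderivable sH Ux.
have dR := mxderivableT (smooth_mxderivable smooth_ricci Ux).
transitivity (\tr (dirmx W (fun y => invmx (g y) *m (ricci_mx g y)^T) x)).
  rewrite dir_sum => [|i a]; last exact: (mxderivableM dH dR).
  by apply: eq_bigr => i _; rewrite [RHS]dirmxE.
rewrite (dirmxM _ dH dR) dirmxT (dirmx_invmx Ux) (dirmx_ricci Ux) /scal.
move: (invmx (g x)) (ricci_mx g x) (B x) => H Ric B0.
have -> : (- (B0 *m Ric) - Ric *m B0^T)^T = - (Ric^T *m B0^T) - B0 *m Ric^T.
  by rewrite raddfB /= raddfN /= !trmx_mul trmxK.
rewrite mulmxBr mulmxN !mulmxDl mulmxA -scalemxAl -!mulmxA [H *m (B0 *m _)]mulmxA.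
have trC : \tr (B0^T *m (H *m Ric^T)) = \tr (H *m (Ric^T *m B0^T)).
  by rewrite mxtrace_mulC -!mulmxA.
rewrite !raddfD /= !raddfN /= linearZ /= trC -!mulmxA /=; ring.
Qed.

End Curvature.

(** * Tensoriality *)

Section ChangeOfCoordinates.
Context {R : realType} {n : nat}.
Variables (O U : set 'rV[R]_n) (openO : open O) (openU : open U).
Variables (T : 'rV[R]_n -> 'rV[R]_n) (sT : smooth_mx O T).
Hypothesis OU : forall x, O x -> U (T x).
Implicit Types (x : 'rV[R]_n) (a b : 'I_n).

Lemma is_derive_comp f a x : smooth_on U f -> O x ->
  is_derive x (delta_mx 0 a : 'rV[R]_n) (f \o T) (\sum_b jac T x a b * partial b f (T x)).
Proof.
move=> sf Ox; have dT := smooth_mxderivable sT Ox.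
pose e := delta_mx 0 a : 'rV[R]_n.
have dc : derivable T x e by apply/derivable_mxP => i b; rewrite ord1; exact: dT.
have [d0 v0] : is_derive (0 : R) 1 (fun t : R => T (t *: e + x)) ('D_e T x).
  by apply/is_derive_lineP; rewrite scale0r add0r; exact: derivableP.
have UT : U (T (0 *: e + x)) by rewrite scale0r add0r; exact: OU.
have := @smooth_is_derive_comp R n U openU f _ 0 _ sf UT (DeriveDef d0 v0).
rewrite -(is_derive_lineP (f \o T)) scale0r add0r.
congr is_derive; apply: eq_bigr => b _; congr (_ * _).
by rewrite (derive_mx dc) [LHS]mxE [RHS]jacE partialE.
Qed.

Lemma mxderivable_comp p q (F : 'rV[R]_n -> 'M[R]_(p, q)) x :
  smooth_mx U F -> O x -> mxderivable (fun y => F (T y)) x.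
Proof. by move=> sF Ox a i j; case: (is_derive_comp a (sF i j) Ox). Qed.

Lemma pmx_comp p q (F : 'rV[R]_n -> 'M[R]_(p, q)) a x :
  smooth_mx U F -> O x ->
  pmx a (fun y => F (T y)) x = \sum_b jac T x a b *: pmx b F (T x).
Proof.
move=> sF Ox; apply/matrixP => i j; rewrite pmxE summxE.
have [_ E] := is_derive_comp a (sF i j) Ox.
rewrite [LHS]E; apply: eq_bigr => b _.
by rewrite [RHS]mxE pmxE.
Qed.

Lemma jac_comp (V : 'rV[R]_n -> 'rV[R]_n) x : smooth_mx U V -> O x ->
  jac (fun y => V (T y)) x = jac T x *m jac V (T x).
Proof.
move=> sV Ox; apply/matrixP => a c; rewrite jacE mxE.
have [_ E] := is_derive_comp a (sV 0 c) Ox.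
by rewrite [LHS]E; apply: eq_bigr => b _; rewrite [jac V _ _ _]jacE.
Qed.

Lemma dirmx_comp p q (V W : 'rV[R]_n -> 'rV[R]_n) (F : 'rV[R]_n -> 'M[R]_(p, q)) x :
  smooth_mx U F -> O x -> W (T x) = V x *m jac T x ->
  dirmx V (fun y => F (T y)) x = dirmx W F (T x).
Proof.
move=> sF Ox WE; rewrite /dirmx WE.
under eq_bigr do rewrite pmx_comp // scaler_sumr.
rewrite exchange_big; apply: eq_bigr => b _ /=.
by rewrite mxE scaler_suml; apply: eq_bigr => a _; rewrite scalerA.
Qed.

Section Fields.
Variables (V V' : 'rV[R]_n -> 'rV[R]_n) (sV : smooth_mx O V) (sV' : smooth_mx U V').
Hypothesis VE : forall x, O x -> V' (T x) = V x *m jac T x.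

(** Differentiating the transformation law of [V] brings in second derivatives of [T]: the term
    [dirmx V (jac T)] is the failure of [jac V] to be a tensor. *)
Lemma jac_field x : O x ->
  jac T x *m jac V' (T x) = jac V x *m jac T x + dirmx V (jac T) x.
Proof.
by move=> Ox; rewrite -jac_comp // (eq_jac openO VE Ox) (jac_mul_jac openO).
Qed.

(** The derivative along V of the two factors [jac T] in the law of g is exactly compensated by the
    non-tensorial terms that [jac_field] attaches to [jac V]. *)
Lemma lie_tensor (g g' : 'rV[R]_n -> 'M[R]_n) x : smooth_mx U g' ->
  (forall y, O y -> g y = jac T y *m g' (T y) *m (jac T y)^T) ->
  O x -> lie V g x = jac T x *m lie V' g' (T x) *m (jac T x)^T.
Proof.
move=> sg' gE Ox.
have dJ := smooth_mxderivable (smooth_jac sT) Ox.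
have dg := mxderivable_comp sg' Ox.
have dJg := mxderivableM dJ dg; have dJT := mxderivableT dJ.
rewrite /lie (gE x Ox) (eq_dirmx openO V gE Ox) (dirmxM _ dJg dJT) (dirmxM _ dJ dg).
rewrite dirmxT (dirmx_comp sg' Ox (VE Ox)).
have E : jac T x *m (jac V' (T x) *m g' (T x)) *m (jac T x)^T =
   (jac V x *m jac T x + dirmx V (jac T) x) *m g' (T x) *m (jac T x)^T.
  by rewrite mulmxA jac_field.
have ET : jac T x *m (g' (T x) *m (jac V' (T x))^T) *m (jac T x)^T =
   jac T x *m g' (T x) *m (jac V x *m jac T x + dirmx V (jac T) x)^T.
  by rewrite -jac_field // trmx_mul !mulmxA.
rewrite !mulmxDr !mulmxDl E ET.
have trD (A B : 'M[R]_n) : (A + B)^T = A^T + B^T by exact: raddfD.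
rewrite trD trmx_mul.
move: (jac V x) (jac T x) (g' (T x)) (dirmx V (jac T) x) (dirmx V' g' (T x)).
by move=> B J G DJ DG; mx_ring.
Qed.

(** Both sides are the Hessian of [T] evaluated on the pair V, W. Hence the non-tensorial
    corrections of the two halves of the bracket cancel. *)
Lemma mul_dirmx_jac_sym (W : 'rV[R]_n -> 'rV[R]_n) x : O x ->
  V x *m dirmx W (jac T) x = W x *m dirmx V (jac T) x.
Proof.
move=> Ox; apply/rowP => b; rewrite [LHS]mxE [RHS]mxE.
have E (V1 V2 : 'rV[R]_n -> 'rV[R]_n) : \sum_a V1 x 0 a * dirmx V2 (jac T) x a b =
    \sum_a \sum_k V1 x 0 a * V2 x 0 k * partial k (partial a (fun y => T y 0 b)) x.
  apply: eq_bigr => a _; rewrite dirmxE mulr_sumr; apply: eq_bigr => k _.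
  have -> : (fun y => jac T y a b) = partial a (fun y => T y 0 b).
    by apply/funext => y; rewrite jacE.
  by rewrite mulrA.
rewrite !E exchange_big /=; apply: eq_bigr => a _; apply: eq_bigr => k _.
have -> := smooth_schwarz openO a k (sT 0 b) Ox.
by rewrite [V x 0 k * _]mulrC.
Qed.

End Fields.

Lemma bracket_tensor (V V' W W' : 'rV[R]_n -> 'rV[R]_n) x :
  smooth_mx O V -> smooth_mx U V' -> smooth_mx O W -> smooth_mx U W' ->
  (forall x, O x -> V' (T x) = V x *m jac T x) ->
  (forall x, O x -> W' (T x) = W x *m jac T x) ->
  O x -> bracket V' W' (T x) = bracket V W x *m jac T x.
Proof.
move=> sV sV' sW sW' VE WE Ox; rewrite /bracket VE // WE //.
rewrite -!mulmxA (jac_field sV sV' VE Ox) (jac_field sW sW' WE Ox) !mulmxDr.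
rewrite (mul_dirmx_jac_sym V W Ox) opprD addrACA subrr addr0 mulmxBl.
by rewrite !mulmxA.
Qed.

End ChangeOfCoordinates.

Lemma sub_smooth_on (R : realType) n (O U : set 'rV[R]_n) f :
  O `<=` U -> smooth_on U f -> smooth_on O f.
Proof.
move=> OU sf k; move: (sf k); elim: k f {sf} => [|k IHk] f [cf df].
  by split=> // x /OU; exact: cf.
split=> [x /OU|a]; first exact: cf.
by have [dfa Cfa] := df a; split=> [x /OU|]; [exact: dfa|exact: IHk].
Qed.

Lemma posdef_unitmx (F : realFieldType) n (G : 'M[F]_n) :
  (forall v : 'rV[F]_n, v != 0 -> 0 < (v *m G *m v^T) 0 0) -> G \in unitmx.
Proof.
move=> pos; rewrite -row_free_unit -kermx_eq0; apply/negPn/negP => K0.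
have := pos (nz_row (kermx G)).
rewrite nz_row_eq0 => /(_ K0).
have /sub_kermxP -> := nz_row_sub (kermx G).
by rewrite mul0mx mxE ltxx.
Qed.

Lemma posdef_neq0 (F : realFieldType) n (G : 'M[F]_n) : (0 < n)%N ->
  (forall v : 'rV[F]_n, v != 0 -> 0 < (v *m G *m v^T) 0 0) -> G != 0.
Proof.
case: n G => // n G _ pos; apply/eqP => G0.
have := pos (const_mx 1); rewrite G0 mulmx0 mul0mx mxE ltxx => H.
have : const_mx 1 != 0 :> 'rV[F]_n.+1.
  by apply/eqP => /rowP/(_ 0); rewrite !mxE => /eqP; rewrite oner_eq0.
by move=> /H.
Qed.

(** * Chart expressions and their compatibility on overlaps *)

Section Manifold.
Context {R : realType} {n : nat} {M : topologicalType}.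
Variable A : smooth_atlas R n M.
Implicit Types (i j : chart_index A) (V W : vector_components A)
  (g : tensor_components A).

Lemma open_chart_image i : open (chart_image i).
Proof. exact: open_image. Qed.

Lemma overlap_chart_image i j : overlap i j `<=` chart_image i.
Proof. by move=> _ [p [ip jp] <-]; exists p. Qed.

Lemma transition_chart_image i j x : overlap i j x -> chart_image j (transition i j x).
Proof. by move=> [p [ip jp] <-]; rewrite /transition chartK //; exists p. Qed.

Lemma open_overlap i j : open (overlap i j).
Proof.
rewrite openE => x [p [ip jp] xE]; rewrite /interior /=.
have ix : chart_image i x by exists p.
have nj : \forall y \near x, dom j (chart_inv i y).
  apply: (chart_inv_continuous ix); apply: open_nbhs_nbhs; split; first exact: open_dom.
  by rewrite -xE chartK.
have ni : \forall y \near x, chart_image i y.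
  by apply: open_nbhs_nbhs; split=> //; exact: open_chart_image.
apply: filterS2 ni nj => _ [q iq <-] /=; rewrite chartK // => jq.
by exists q.
Qed.

Lemma smooth_transition i j : smooth_mx (overlap i j) (transition i j).
Proof. by move=> a b; rewrite ord1; exact: transition_smooth. Qed.

Lemma lie_derivativeE V g i x : lie_derivative V g i x = lie (V i) (g i) x.
Proof.
apply/matrixP => a b; rewrite mxE /lie [RHS]mxE [X in _ = X + _]mxE dirmxE.
rewrite [X in _ = _ + X + _]mxE [X in _ = _ + X]mxE !big_split /=; congr (_ + _ + _).
  by apply: eq_bigr => k _; rewrite jacE mulrC.
by apply: eq_bigr => k _; rewrite [_^T _ _]mxE jacE.
Qed.

Lemma lie_bracketE V W i x : lie_bracket V W i x = bracket (V i) (W i) x.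
Proof.
apply/rowP => a; rewrite mxE [RHS]mxE [X in _ = X + _]mxE [X in _ = _ + X]mxE.
rewrite [X in _ = _ - X]mxE -sumrB; apply: eq_bigr => k _.
by rewrite !jacE.
Qed.

Lemma smooth_field V i : smooth_vector_field V -> smooth_mx (chart_image i) (V i).
Proof. by move=> [sV _] a b; rewrite ord1. Qed.

Lemma smooth_field_overlap V i j : smooth_vector_field V -> smooth_mx (overlap i j) (V i).
Proof.
move=> sV a b; apply: sub_smooth_on (smooth_field i sV a b).
exact: overlap_chart_image.
Qed.

Lemma field_transition V i j : smooth_vector_field V ->
  forall x, overlap i j x -> V j (transition i j x) = V i x *m jac (transition i j) x.
Proof. by move=> [_ tV] x; exact: tV. Qed.

Lemma smooth_lie_bracket V W : smooth_vector_field V -> smooth_vector_field W ->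
  smooth_vector_field (lie_bracket V W).
Proof.
move=> sV sW; split=> [i a|i j x ijx].
  have := smooth_bracket (@open_chart_image i) (smooth_field i sV) (smooth_field i sW) 0 a.
  apply: eq_smooth_on; first exact: open_chart_image.
  by move=> x _; rewrite lie_bracketE.
rewrite !lie_bracketE.
apply: (bracket_tensor (@open_overlap i j) (@open_chart_image j) (@smooth_transition i j)) => //.
- exact: transition_chart_image.
- exact: smooth_field_overlap.
- exact: smooth_field.
- exact: smooth_field_overlap.
- exact: smooth_field.
- exact: field_transition.
- exact: field_transition.
Qed.

Section Metric.
Variables (g : tensor_components A) (rg : riemannian_metric g).

Lemma metric_smooth i : smooth_mx (chart_image i) (g i).
Proof. by case: rg => sg _ _ _ a b; exact: sg. Qed.

Lemma riemannian_sym i x : chart_image i x -> (g i x)^T = g i x.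
Proof. by case: rg => _ + _ _; exact. Qed.

Lemma metric_pos i x : chart_image i x -> forall v : 'rV[R]_n, v != 0 ->
  0 < (v *m g i x *m v^T) 0 0.
Proof. by case: rg => _ _ + _; exact. Qed.

Lemma metric_ge0 i x (v : 'rV[R]_n) : chart_image i x -> 0 <= (v *m g i x *m v^T) 0 0.
Proof.
move=> ix; have [->|/(metric_pos ix)/ltW //] := eqVneq v 0.
by rewrite mul0mx mul0mx mxE.
Qed.

Lemma metric_unit i x : chart_image i x -> g i x \in unitmx.
Proof. by move=> ix; apply: posdef_unitmx; exact: metric_pos. Qed.

Lemma metric_transition i j x : overlap i j x ->
  g i x = jac (transition i j) x *m g j (transition i j x) *m (jac (transition i j) x)^T.
Proof. by case: rg => _ _ _; exact. Qed.

Lemma lie_transition V i j x : smooth_vector_field V -> overlap i j x ->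
  lie (V i) (g i) x = jac (transition i j) x *m lie (V j) (g j) (transition i j x)
    *m (jac (transition i j) x)^T.
Proof.
move=> sV ijx.
apply: (lie_tensor (@open_overlap i j) (@open_chart_image j) (@smooth_transition i j)) => //.
- exact: transition_chart_image.
- exact: smooth_field_overlap.
- exact: smooth_field.
- exact: field_transition.
- exact: metric_smooth.
- exact: metric_transition.
Qed.

(** Both L_V g and g are tensors and g is nonzero, so the factor between them is a scalar. Applied
    to a soliton, this shows that the scalar curvature does not depend on the chart, without
    transforming the curvature tensor. *)
Lemma conformal_factor_transition V (r : chart_index A -> 'rV[R]_n -> R) : (0 < n)%N ->
  smooth_vector_field V ->
  (forall i x, chart_image i x -> lie (V i) (g i) x = r i x *: g i x) ->
  forall i j x, overlap i j x -> r i x = r j (transition i j x).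
Proof.
move=> n0 sV E i j x ijx; have ix := overlap_chart_image ijx.
have := lie_transition sV ijx; rewrite !E //; last exact: transition_chart_image.
rewrite -scalemxAr -scalemxAl -metric_transition // => /eqP.
rewrite -subr_eq0 -scalerBl scaler_eq0 subr_eq0 => /orP[/eqP //|].
by rewrite (negbTE (posdef_neq0 n0 (metric_pos ix))).
Qed.

Lemma norm_transition (v : 'rV[R]_n) i j x : overlap i j x ->
  (v *m g i x *m v^T) 0 0 =
  (v *m jac (transition i j) x *m g j (transition i j x) *m (v *m jac (transition i j) x)^T) 0 0.
Proof. by move=> ijx; rewrite (metric_transition ijx) trmx_mul !mulmxA. Qed.

Lemma christoffelE i x c a b : chart_image i x ->
  christoffel g i c a b x = connection (g i) a x b c.
Proof.
move=> ix; rewrite /connection mxE /christoffel mulr_sumr.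
apply: eq_bigr => l _; rewrite [first_kind _ _ _ _ _]mxE [X in _ = _ * X * _]mxE !pmxE.
have -> : invmx (g i x) l c = invmx (g i x) c l.
  by rewrite -[in LHS](riemannian_sym ix) -trmx_inv mxE.
by ring.
Qed.

Lemma riemannE i x d c a b : chart_image i x ->
  riemann g i d c a b x = curvature (connection (g i)) a b x c d.
Proof.
move=> ix; have E e p q : partial e (christoffel g i d p q) x = pmx e (connection (g i) p) x q d.
  rewrite pmxE; apply: (eq_partial_on (@open_chart_image i)) => // y iy.
  exact: christoffelE.
rewrite /riemann !E /curvature [RHS]mxE [X in _ = X + _]mxE [X in _ = _ + X + _]mxE.
congr (_ + _).
rewrite sumrB [RHS]mxE [X in _ = X + _]mxE [X in _ = _ + X]mxE [in X in _ = _ + X]mxE.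
by congr (_ - _); apply: eq_bigr => m _; rewrite !christoffelE // mulrC.
Qed.

Lemma scalar_curvatureE i x : chart_image i x ->
  scalar_curvature g i x = scal (g i) x.
Proof.
move=> ix; rewrite /scal /mxtrace; apply: eq_bigr => c _.
rewrite [RHS]mxE; apply: eq_bigr => b _; rewrite [_^T _ _]mxE [ricci_mx _ _ _ _]mxE.
by congr (_ * _); apply: eq_bigr => a _; exact: riemannE.
Qed.

Lemma smooth_scalar_curvature i : smooth_on (chart_image i) (scal (g i)).
Proof.
apply: smooth_scal; first exact: open_chart_image.
- exact: metric_smooth.
- exact: metric_unit.
Qed.

Lemma lie_sub V W i x : smooth_vector_field V -> smooth_vector_field W ->
  chart_image i x ->
  lie (fun y => V i y - W i y) (g i) x = lie (V i) (g i) x - lie (W i) (g i) x.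
Proof.
move=> sV sW ix; rewrite /lie.
have -> : jac (fun y => V i y - W i y) x = jac (V i) x - jac (W i) x.
  by apply: jacB; apply: smooth_mxderivable ix; exact: smooth_field.
have -> : dirmx (fun y => V i y - W i y) (g i) x = dirmx (V i) (g i) x - dirmx (W i) (g i) x.
  rewrite /dirmx -sumrB; apply: eq_bigr => k _.
  by rewrite [_ 0 k]mxE [X in V i x 0 k + X]mxE scalerBl.
rewrite raddfB /= mulmxBl mulmxBr.
by apply/matrixP => a b; rewrite ![in LHS]mxE ![in RHS]mxE; ring.
Qed.

Lemma dir_scalar_curvature (W : 'rV[R]_n -> 'rV[R]_n) i x (s : R) :
  smooth_mx (chart_image i) W ->
  (forall y, chart_image i y -> lie W (g i) y = s *: g i y) ->
  chart_image i x -> dir W (scal (g i)) x = - s * scal (g i) x.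
Proof.
move=> sW hW ix; apply: dir_scal ix => //; first exact: open_chart_image.
- exact: metric_smooth.
- exact: riemannian_sym.
- exact: metric_unit.
Qed.

End Metric.
End Manifold.

(** * The Riemannian distance *)

Section RealAnalysis.
Context {R : realType}.
Local Notation mu := (@lebesgue_measure R).

(** Serves integrands such as [speed], whose measurability is not at hand: a nonnegative integral is
    a supremum over the simple functions below the integrand, and those families are nested. *)
Lemma ge0_integral_mono (D : set R) (f g : R -> \bar R) :
  (forall x, D x -> (0 <= f x)%E) -> (forall x, D x -> (f x <= g x)%E) ->
  (\int[mu]_(x in D) f x <= \int[mu]_(x in D) g x)%E.
Proof.
move=> f0 fg; rewrite !ge0_integralE //; last by move=> x Dx; exact: le_trans (f0 x Dx) (fg x Dx).
apply: le_ereal_sup => _ [h hf <-]; exists h => // x.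
apply: le_trans (hf x) _; rewrite /patch; case: ifP => // /set_mem Dx; exact: fg.
Qed.

Lemma abs_increment_le_integral (F G s : R -> R) (a b : R) : a <= b ->
  (forall t, a <= t <= b -> is_derive t 1 F (G t) /\ {for t, continuous G}) ->
  (forall t, a <= t <= b -> `|G t| <= s t) ->
  (`|F b - F a|%:E <= \int[mu]_(t in `[a, b]) (s t)%:E)%E.
Proof.
rewrite le_eqVlt => /orP[/eqP <- _ Gs|ab dF Gs].
  rewrite subrr normr0; apply: integral_ge0 => t; rewrite /= in_itv /= => tab.
  by rewrite lee_fin (le_trans _ (Gs t tab)).
have cG : {within `[a, b], continuous G}.
  apply: continuous_in_subspaceT => t; rewrite inE /= in_itv /= => tab.
  by case: (dF t tab).
have dFt t : a <= t <= b -> {for t, continuous F}.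
  move=> /dF[[d _] _]; apply: differentiable_continuous.
  exact/derivable1_diffP.
have E : (\int[mu]_(t in `[a, b]) (G t)%:E = (F b)%:E - (F a)%:E)%E.
  apply: continuous_FTC2 => //.
    split.
    - by move=> t; rewrite in_itv /= => /andP[at_ tb]; case: (dF t _) => [|[]//]; rewrite !ltW.
    - by apply: cvg_at_right_filter; apply: dFt; rewrite lexx ltW.
    - by apply: cvg_at_left_filter; apply: dFt; rewrite lexx ltW.
  move=> t; rewrite in_itv /= => /andP[at_ tb]; rewrite derive1E.
  by case: (dF t _) => [|[]//]; rewrite !ltW.
have /integrableP[mG _] := continuous_compact_integrable (@segment_compact _ a b) cG.
have -> : (`|F b - F a|%:E = `|\int[mu]_(t in `[a, b]) (G t)%:E|)%E by rewrite E.
apply: le_trans (le_abse_integral _ _ _) _ => //.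
apply: ge0_integral_mono => t; first by rewrite abse_ge0.
by rewrite /= in_itv /= => tab; rewrite lee_fin; exact: Gs.
Qed.

(** The square makes the positive part C^1, so a cut-off built from it has a continuous derivative
    along C^1 curves, as the fundamental theorem of calculus requires. *)
Lemma is_derive_sqr_pos (s : R) :
  is_derive s 1 (fun t : R => Num.max 0 t ^+ 2) (2 * Num.max 0 s).
Proof.
have [s0|s0|->] := ltgtP s 0.
- apply: (near_eq_is_derive (f := cst 0)).
    near=> t; rewrite /= max_l ?expr0n //; apply: ltW.
    by near: t; exact: lt_nbhsl.
  by rewrite mulr0; exact: is_derive_cst.
- apply: (near_eq_is_derive (f := fun t : R => t ^+ 2)).
    near=> t; rewrite /= max_r //; apply: ltW.
    by near: t; exact: lt_nbhsr.
  have /(is_derive_eq (df := _)) := @is_deriveX _ _ id 2 s 1 1 (is_derive_id _ _).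
  by apply; rewrite expr1 /GRing.scale /= mulr1.
- rewrite mulr0.
  have cv : h^-1 *: ((fun t : R => Num.max 0 t ^+ 2) (h *: 1 + 0) - Num.max 0 0 ^+ 2)
      @[h --> 0^'] --> (0 : R).
    apply/cvgrPdist_le => e e0; near=> h.
    rewrite sub0r normrN maxxx expr0n subr0 addr0 [h *: 1]mulr1 /GRing.scale /= normrM normfV.
    have h0 : h != 0 by near: h; exact: nbhs_dnbhs_neq.
    rewrite ler_pdivrMl ?normr_gt0 // expr2 normrM; apply: ler_pM => //.
      by rewrite ger0_norm ?le_max ?lexx // ge_max normr_ge0 ler_norm.
    have he : `|h| <= e by near: h; apply: dnbhs0_le.
    apply: le_trans he; rewrite ger0_norm ?le_max ?lexx // ge_max normr_ge0 ler_norm //.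
  split; first by apply/cvg_ex; exists 0.
  exact: cvg_lim.
Unshelve. all: by end_near. Qed.

Lemma near_realP (t : R) (P : set R) :
  (\forall y \near t, P y) <->
  exists2 e : R, 0 < e & forall y, `|y - t| < e -> P y.
Proof.
split=> [/nbhs_ballP[e /= e0 eP]|[e e0 eP]].
  by exists e => // y yx; apply: eP; rewrite -ball_normE /= distrC.
apply/nbhs_ballP; exists e => // y; rewrite -ball_normE /= distrC; exact: eP.
Qed.

Context {n : nat}.

Lemma continuous_row (c : R -> 'rV[R]_n) (t : R) :
  (forall b, {for t, continuous (fun s => c s 0 b)}) -> {for t, continuous c}.
Proof.
move=> cc; apply/cvgrPdist_le => e e0; near=> s.
apply: norm_row_le; first exact: ltW.
move=> b; rewrite !mxE; move: b; near: s; apply: filter_forall => b.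
by have /cvgrPdist_le := cc b; exact.
Unshelve. all: by end_near. Qed.

Lemma continuous_coord_row (c : R -> 'rV[R]_n) (t : R) b :
  {for t, continuous c} -> {for t, continuous (fun s => c s 0 b)}.
Proof.
move=> cc; apply: (@continuous_comp _ _ _ c (fun x : 'rV[R]_n => x 0 b)) => //.
exact: coord_continuous.
Qed.

Lemma is_derive_row (c : R -> 'rV[R]_n) (t : R) (d : 'rV[R]_n) :
  (forall b, is_derive t 1 (fun s => c s 0 b) (d 0 b)) -> is_derive t 1 c d.
Proof.
move=> dc; have dct : derivable c t 1.
  by apply/derivable_mxP => i b; rewrite ord1; case: (dc b).
split=> //; rewrite derive_mx //; apply/rowP => b; rewrite mxE.
by case: (dc b).
Qed.

Lemma is_derive_coord (c : R -> 'rV[R]_n) (t : R) (d : 'rV[R]_n) b :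
  is_derive t 1 c d -> is_derive t 1 (fun s => c s 0 b) (d 0 b).
Proof.
move=> [dc <-]; split; first by have /derivable_mxP := dc; exact.
by rewrite derive_mx // mxE.
Qed.

End RealAnalysis.

Lemma continuous_sum (R : realType) (T : topologicalType) (I : Type) (r : seq I)
    (F : I -> T -> R) (x : T) :
  (forall i, {for x, continuous (F i)}) ->
  {for x, continuous (fun y => \sum_(i <- r) F i y)}.
Proof.
move=> cF; apply: (@cvg_big _ _ _ _ _ _ _ (nbhs x)) => [|i _]; last exact: cF.
exact: add_continuous.
Qed.

(** Cauchy-Schwarz for a covector [w] and a vector [v], each measured in its own norm. It follows
    from nonnegativity of the quadratic polynomial s -> |v + s w'|^2, where w' is the vector dual to
    [w]. *)
Lemma posdef_cauchy_schwarz (F : realFieldType) n (G : 'M[F]_n) (w v : 'rV[F]_n) :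
  G^T = G -> G \in unitmx -> (forall u : 'rV[F]_n, 0 <= (u *m G *m u^T) 0 0) ->
  ((w *m v^T) 0 0) ^+ 2 <= (w *m invmx G *m w^T) 0 0 * (v *m G *m v^T) 0 0.
Proof.
move=> Gs Gu Gp; set a := (v *m G *m v^T) 0 0; set b := (w *m v^T) 0 0.
set c := (w *m invmx G *m w^T) 0 0.
have q s : 0 <= a + s * b *+ 2 + s ^+ 2 * c.
  have := Gp (v + s *: (w *m invmx G)).
  have -> : (v + s *: (w *m invmx G)) *m G = v *m G + s *: w.
    by rewrite mulmxDl -scalemxAl -mulmxA mulVmx // mulmx1.
  have -> : (v + s *: (w *m invmx G))^T = v^T + s *: (invmx G *m w^T).
    by rewrite linearD /= linearZ /= trmx_mul trmx_inv Gs.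
  have vw : (v *m w^T) 0 0 = b.
    by rewrite -[v *m w^T]trmxK trmx_mul trmxK mxE.
  rewrite mulmxDl !mulmxDr -!scalemxAl -!scalemxAr.
  have -> : v *m G *m (invmx G *m w^T) = v *m w^T by rewrite mulmxA mulmxK.
  have E (X1 X2 X3 X4 : 'M[F]_1) : (X1 + s *: X2 + (s *: X3 + s *: (s *: X4))) 0 0 =
      X1 0 0 + s * X2 0 0 + (s * X3 0 0 + s * (s * X4 0 0)) by rewrite !mxE.
  rewrite mulmxA E -/a -/b -/c vw => H; apply: le_trans H _.
  by rewrite le_eqVlt; apply/orP; left; apply/eqP; ring.
have a0 : 0 <= a by exact: Gp.
have c0 : 0 <= c.
  have := Gp (w *m invmx G); rewrite -mulmxA trmx_mul trmx_inv Gs.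
  by rewrite -mulmxA mulKVmx // mulmxA.
have [c00|c00] := eqVneq c 0.
  rewrite c00 mul0r real_leNgt ?num_real //; apply/negP => b2.
  have b0 : b != 0 by apply: contraTneq b2 => ->; rewrite expr0n ltxx.
  (* With no quadratic term the polynomial is affine with nonzero slope; this argument gives it the
     value -1. *)
  have := q (- (a + 1) / (2 * b)); rewrite c00 mulr0 addr0.
  have -> : a + - (a + 1) / (2 * b) * b *+ 2 = -1 by field.
  by rewrite lerNr oppr0 ler10.
have cp : 0 < c by rewrite lt_def c00.
(* The minimizer of the quadratic polynomial. *)
have := q (- b / c).
have -> : a + - b / c * b *+ 2 + (- b / c) ^+ 2 * c = (c * a - b ^+ 2) / c by field.
by rewrite pmulr_lge0 ?invr_gt0 // subr_ge0.
Qed.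

Lemma is_derive_comp_curve (R : realType) n (O : set 'rV[R]_n) (T : 'rV[R]_n -> 'rV[R]_n)
    (c : R -> 'rV[R]_n) (t : R) (dc : 'rV[R]_n) :
  open O -> smooth_mx O T -> O (c t) -> is_derive t 1 c dc ->
  is_derive t 1 (fun s => T (c s)) (dc *m jac T (c t)).
Proof.
move=> openO sT Oct dct; apply: is_derive_row => b.
have [d E] := smooth_is_derive_comp openO (sT 0 b) Oct dct.
split; first exact: d.
by rewrite [LHS]E mxE; apply: eq_bigr => a _; rewrite jacE.
Qed.

Section Distance.
Context {R : realType} {n : nat} {M : topologicalType}.
Variable A : smooth_atlas R n M.
Implicit Types (i j : chart_index A).
Variables (g : tensor_components A) (rg : riemannian_metric g).

Lemma speed_ge0 gamma t : 0 <= speed g gamma t.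
Proof. exact: sqrtr_ge0. Qed.

Lemma curve_length_ge0 gamma a b : (0 <= curve_length g gamma a b)%E.
Proof. by apply: integral_ge0 => t _; rewrite lee_fin speed_ge0. Qed.

Lemma joined_ge0 p q L : joined g p q L -> (0 <= L)%E.
Proof. by elim=> [//|{}L gamma a b ab _ _ L0]; apply: adde_ge0 => //; exact: curve_length_ge0. Qed.

Lemma joined_trans p q r L1 L2 : joined g p q L1 -> joined g q r L2 ->
  joined g p r (L1 + L2)%E.
Proof.
move=> pq; elim=> [|L gamma a b ab c1 _ IH]; first by rewrite adde0.
by rewrite addeA; apply: joined_step.
Qed.

Lemma dist_joined p q L : joined g p q L -> (riemannian_distance g p q <= L)%E.
Proof. by move=> pqL; apply: ereal_inf_lbound. Qed.

Lemma dist_lt_joined p q (c : R) : (riemannian_distance g p q < c%:E)%E ->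
  exists2 L, joined g p q L & (L < c%:E)%E.
Proof. by move=> /ereal_inf_lt[L pqL Lc]; exists L. Qed.

(** Stated through real upper bounds, so that infinite distances between components never enter the
    arithmetic. *)
Lemma dist_triangle p q r (c d : R) :
  (riemannian_distance g p q <= c%:E)%E -> (riemannian_distance g q r <= d%:E)%E ->
  (riemannian_distance g p r <= (c + d)%:E)%E.
Proof.
move=> pq qr; apply/lee_addgt0Pr => e e0.
have e2 : 0 < e / 2 by rewrite divr_gt0.
have /dist_lt_joined[L1 j1 l1] : (riemannian_distance g p q < (c + e / 2)%:E)%E.
  by apply: le_lt_trans pq _; rewrite lte_fin ltrDl.
have /dist_lt_joined[L2 j2 l2] : (riemannian_distance g q r < (d + e / 2)%:E)%E.
  by apply: le_lt_trans qr _; rewrite lte_fin ltrDl.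
apply: le_trans (dist_joined (joined_trans j1 j2)) _.
apply: le_trans (leeD (ltW l1) (ltW l2)) _.
by rewrite -!EFinD lee_fin; lra.
Qed.

Lemma dist_refl p : (riemannian_distance g p p <= 0)%E.
Proof. by apply: dist_joined; exact: joined_refl. Qed.

Lemma dom_near gamma (t : R) i : {for t, continuous gamma} -> dom i (gamma t) ->
  \forall s \near t, dom i (gamma s).
Proof.
move=> cg it; apply: cg; apply: open_nbhs_nbhs; split=> //; exact: open_dom.
Qed.

Lemma overlap_chart i j p : dom i p -> dom j p -> overlap i j (chart i p).
Proof. by move=> ip jp; exists p. Qed.

Lemma is_derive_chart gamma (t : R) i j (dc : 'rV[R]_n) :
  {for t, continuous gamma} -> dom i (gamma t) -> dom j (gamma t) ->
  is_derive t 1 (chart i \o gamma) dc ->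
  is_derive t 1 (chart j \o gamma) (dc *m jac (transition i j) (chart i (gamma t))).
Proof.
move=> cg it jt dct.
apply: (near_eq_is_derive (f := fun s => transition i j (chart i (gamma s)))).
  apply: filterS (dom_near cg it) => s si.
  by rewrite /transition chartK.
apply: (is_derive_comp_curve (@open_overlap _ _ _ _ i j) (@smooth_transition _ _ _ _ i j) _ dct).
exact: overlap_chart.
Qed.

(** The chart in the definition of [speed] changes with the point of the curve; here the speed is
    read in one chart along a whole piece of it. *)
Lemma speedE gamma (t : R) i : C1_curve_at A gamma t -> dom i (gamma t) ->
  let v := derive1 (chart i \o gamma) t in
  speed g gamma t = Num.sqrt ((v *m g i (chart i (gamma t)) *m v^T) 0 0).
Proof.
move=> [cg C1] it v; rewrite /speed.
set j := chart_at A (gamma t); have jt : dom j (gamma t) by exact: dom_chart_at.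
have dct : is_derive t 1 (chart i \o gamma) v.
  have [dd _] := C1 i it.
  by split; [exact: dd|exact/esym/derive1E].
have [_ E] := is_derive_chart cg it jt dct.
rewrite derive1E E (norm_transition rg v (overlap_chart it jt)).
by rewrite /transition chartK.
Qed.

Lemma chart_invK i x : chart_image i x -> chart i (chart_inv i x) = x.
Proof. by move=> [p ip <-]; rewrite chartK. Qed.

Lemma dom_chart_inv i x : chart_image i x -> dom i (chart_inv i x).
Proof. by move=> [p ip <-]; rewrite chartK. Qed.

Lemma is_derive_affine (y v : 'rV[R]_n) (t : R) :
  is_derive t 1 (fun s : R => s *: v + y) v.
Proof. by apply/(is_derive_lineP id); exact: is_derive_id. Qed.

Lemma continuous_affine (y v : 'rV[R]_n) (t : R) :
  {for t, continuous (fun s : R => s *: v + y)}.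
Proof.
apply: differentiable_continuous; apply/derivable1_diffP.
by case: (is_derive_affine y v t).
Qed.

Lemma near_affine (O : set 'rV[R]_n) (y v : 'rV[R]_n) (t : R) : open O ->
  O (t *: v + y) -> \forall s \near t, O (s *: v + y).
Proof.
by move=> openO Ot; apply: (continuous_affine (y := y)); apply: open_nbhs_nbhs.
Qed.

Lemma C1_segment i (y v : 'rV[R]_n) (t : R) : chart_image i (t *: v + y) ->
  C1_curve_at A (fun s : R => chart_inv i (s *: v + y)) t.
Proof.
move=> it; split.
  apply: (@continuous_comp _ _ _ (fun s : R => s *: v + y) (chart_inv i)).
    exact: continuous_affine.
  exact: chart_inv_continuous.
move=> j jt; have ijt : overlap i j (t *: v + y).
  by exists (chart_inv i (t *: v + y)); [split=> //; exact: dom_chart_inv|exact: chart_invK].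
have dT s : overlap i j (s *: v + y) ->
    is_derive s 1 (fun s : R => transition i j (s *: v + y)) (v *m jac (transition i j) (s *: v + y)).
  move=> ijs; apply: (is_derive_comp_curve (@open_overlap _ _ _ A i j)) => //.
    exact: smooth_transition.
  exact: is_derive_affine.
split; first by case: (dT t ijt).
apply: (near_eq_continuous (f := fun s : R => v *m jac (transition i j) (s *: v + y))).
  apply: filterS (near_affine (@open_overlap _ _ _ A i j) ijt) => s ijs.
  by have [_ E] := dT s ijs; rewrite derive1E; exact/esym/E.
apply: continuous_row => b.
have -> : (fun s : R => (v *m jac (transition i j) (s *: v + y)) 0 b) =
    (fun s : R => \sum_a v 0 a * jac (transition i j) (s *: v + y) a b).
  by apply/funext => s; rewrite mxE.
apply: continuous_sum => a; apply: continuousM; first exact: cst_continuous.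
apply: (@continuous_comp _ _ _ (fun s : R => s *: v + y) (fun x => jac (transition i j) x a b)).
  exact: continuous_affine.
exact: (smooth_continuous (smooth_jac (@smooth_transition _ _ _ A i j) a b) ijt).
Qed.

Lemma speed_segment i (y v : 'rV[R]_n) (t : R) : chart_image i (t *: v + y) ->
  speed g (fun s : R => chart_inv i (s *: v + y)) t =
  Num.sqrt ((v *m g i (t *: v + y) *m v^T) 0 0).
Proof.
move=> it; rewrite (speedE (C1_segment it) (dom_chart_inv it)) /=.
have -> : derive1 (chart i \o (fun s : R => chart_inv i (s *: v + y))) t = v.
  have [_ E] := is_derive_affine y v t; rewrite derive1E -[RHS]E.
  apply: near_eq_derive.
  apply: filterS (near_affine (@open_chart_image _ _ _ A i) it) => s si /=.
  exact: chart_invK.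
by rewrite chart_invK.
Qed.

(** The segment is followed for t in ]-1, 2[ because [C1_curve_on] on [0, 1] asks for an extension
    beyond both ends; the margin taken is 1. *)
Lemma dist_segment i (y v : 'rV[R]_n) (K : R) :
  (forall t : R, -1 < t -> t < 2 -> chart_image i (t *: v + y)) ->
  (forall t : R, 0 <= t <= 1 -> Num.sqrt ((v *m g i (t *: v + y) *m v^T) 0 0) <= K) ->
  (riemannian_distance g (chart_inv i y) (chart_inv i (v + y)) <= K%:E)%E.
Proof.
move=> yv vK; pose c (s : R) := chart_inv i (s *: v + y).
have J : joined g (chart_inv i y) (chart_inv i (v + y)) (0 + curve_length g c 0 1)%E.
  have -> : chart_inv i (v + y) = c 1 by rewrite /c scale1r.
  apply: joined_step; first exact: ler01.
    exists 1 => // t; rewrite sub0r => t1 t2; apply: C1_segment; exact: yv.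
  by rewrite /c scale0r add0r; exact: joined_refl.
apply: le_trans (dist_joined J) _; rewrite add0e.
apply: (@le_trans _ _ (\int[@lebesgue_measure R]_(t in `[0%R, 1%R]) K%:E)%E).
  apply: ge0_integral_mono => t; first by rewrite lee_fin speed_ge0.
  rewrite /= in_itv /= => /andP[t0 t1]; rewrite lee_fin speed_segment.
    by apply: vK; rewrite t0.
  by apply: yv; lra.
rewrite integral_cst //= lebesgue_measure_itv /= lte_fin ltr01.
by rewrite -EFinD oppr0 addr0 mule1.
Qed.

(** * A bump function that traps points close in the Riemannian distance inside a chart *)

Section Bump.
Hypothesis M_hausdorff : hausdorff_space M.
Variables (i : chart_index A) (x0 : 'rV[R]_n) (r : R).
Hypothesis r0 : 0 < r.
Hypothesis ball_image : forall y, `|y - x0| <= r -> chart_image i y.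
Hypothesis ball_dual : forall y, `|y - x0| <= r ->
  ((y - x0) *m invmx (g i y) *m (y - x0)^T) 0 0 <= 1.

(** The Euclidean square is smooth, unlike the sup norm of row vectors. Positivity of [rho] places y
    in the Euclidean ball, which lies in the sup-norm ball where the hypotheses hold. *)
Let rho (y : 'rV[R]_n) : R := r ^+ 2 - \sum_k (y 0 k - x0 0 k) ^+ 2.

(* The gradient of bump has g-norm at most 1, because the dual norm of y - x0 is at most 1
   on the ball; hence bump is 1-Lipschitz for the Riemannian distance, and a point close to
   the centre cannot lie outside of the ball, where bump vanishes. *)
Definition bump (p : M) : R :=
  if pselect (dom i p) then Num.max 0 (rho (chart i p)) ^+ 2 / (4 * r ^+ 2) else 0.

Lemma rho_gt0 y : 0 < rho y -> `|y - x0| <= r.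
Proof.
rewrite subr_gt0 => H; apply: norm_row_le; first exact: ltW.
move=> a; rewrite !mxE -(@ler_pXn2r _ 2) ?nnegrE ?(ltW r0) // real_normK ?num_real //.
apply: le_trans (ltW H); rewrite (bigD1 a) //= lerDl.
by apply: sumr_ge0 => k _; exact: sqr_ge0.
Qed.

Lemma rho_le y : rho y <= r ^+ 2.
Proof. by rewrite gerBl; apply: sumr_ge0 => k _; exact: sqr_ge0. Qed.

(** A compact set of a Hausdorff space is closed. Thus its complement is a neighbourhood of every
    point outside the chart domain, and the extension of [bump] by zero stays C^1 along curves
    leaving the chart. *)
Lemma closed_ball_chart : closed (chart_inv i @` [set y | `|y - x0| <= r]).
Proof.
apply: compact_closed => //; apply: continuous_compact.
  apply: continuous_in_subspaceT => y; rewrite inE /= => yr.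
  by apply: chart_inv_continuous; exact: ball_image.
have -> : [set y | `|y - x0| <= r] = closed_ball x0 r.
  by rewrite closed_ballE //; apply/seteqP; split=> y; rewrite /= distrC.
apply: bounded_closed_compact; last by rewrite closed_ballE //; exact: closed_closed_ball_.
exists (`|x0| + r); split; first exact: num_real.
move=> K Kr y; rewrite closed_ballE //= => yr.
apply: le_trans (ltW Kr); rewrite -[y](subrK x0) addrC (le_trans (ler_normD _ _)) //.
by rewrite lerD2l distrC.
Qed.

Lemma bump_outside p : ~ (chart_inv i @` [set y | `|y - x0| <= r]) p ->
  dom i p -> rho (chart i p) <= 0.
Proof.
move=> np ip; rewrite leNgt; apply/negP => /rho_gt0 H; apply: np.
by exists (chart i p) => //; rewrite chartK.
Qed.

Lemma is_derive_bump_formula (c : R -> 'rV[R]_n) (t : R) (dc : 'rV[R]_n) :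
  is_derive t 1 c dc ->
  is_derive t 1 (fun s => Num.max 0 (rho (c s)) ^+ 2 / (4 * r ^+ 2))
    (- (Num.max 0 (rho (c t)) * ((c t - x0) *m dc^T) 0 0) / r ^+ 2).
Proof.
move=> dct.
have drho : is_derive t 1 (fun s => rho (c s)) (- (2 * ((c t - x0) *m dc^T) 0 0)).
  have dk k : is_derive t 1 (fun s => (c s 0 k - x0 0 k) ^+ 2) (2 * ((c t 0 k - x0 0 k) * dc 0 k)).
    have d1 : is_derive t 1 (fun s => c s 0 k - x0 0 k) (dc 0 k).
      have d0 := is_derive_coord k dct.
      apply: is_derive_eq; exact: subr0.
    have -> : (fun s => (c s 0 k - x0 0 k) ^+ 2) =
        (fun s => c s 0 k - x0 0 k) * (fun s => c s 0 k - x0 0 k).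
      by apply/funext => s; rewrite expr2.
    apply: is_derive_eq; rewrite /GRing.scale /=; ring.
  have -> : (fun s => rho (c s)) = cst (r ^+ 2) - \sum_k (fun s => (c s 0 k - x0 0 k) ^+ 2).
    by apply/funext => s; rewrite /rho /= [RHS]/GRing.add /= /GRing.opp /= fct_sumE.
  have [dd dv] := is_deriveB (is_derive_cst (r ^+ 2) t 1) (is_derive_sum dk).
  split; first exact: dd.
  rewrite [LHS]dv sub0r mxE; congr (- _); rewrite mulr_sumr; apply: eq_bigr => k _.
  by rewrite !mxE.
have d1 := @is_derive1_comp R (fun u : R => Num.max 0 u ^+ 2) (fun s => rho (c s)) t _ _
  (is_derive_sqr_pos (rho (c t))) drho.
have -> : (fun s => Num.max 0 (rho (c s)) ^+ 2 / (4 * r ^+ 2)) =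
    (4 * r ^+ 2)^-1 *: ((fun u : R => Num.max 0 u ^+ 2) \o (fun s => rho (c s))).
  by apply/funext => s /=; rewrite mulrC.
apply: is_derive_eq; rewrite /GRing.scale /=.
move: (Num.max _ _) (_ 0 0) => u w; field.
by rewrite gt_eqF.
Qed.

(** Uses [rho y <= r ^+ 2] and Cauchy-Schwarz with the covector y - x0, of dual norm at most 1. The
    normalization 4 r^2 in [bump] is the one that makes the resulting bound exactly the speed. *)
Lemma bump_derivative_bound (y v : 'rV[R]_n) : chart_image i y ->
  `|- (Num.max 0 (rho y) * ((y - x0) *m v^T) 0 0) / r ^+ 2| <=
  Num.sqrt ((v *m g i y *m v^T) 0 0).
Proof.
move=> iy; case: (lerP (rho y) 0) => [_|rho0].
  by rewrite mul0r oppr0 mul0r normr0 sqrtr_ge0.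
have yr := rho_gt0 rho0.
rewrite normrM normrN normrM (gtr0_norm rho0) [`|_^-1|]gtr0_norm ?invr_gt0 ?exprn_gt0 //.
rewrite ler_pdivrMr ?exprn_gt0 // mulrC; apply: ler_pM; rewrite ?(ltW rho0) ?rho_le //.
rewrite -sqrtr_sqr; apply: ler_wsqrtr.
have pos (u : 'rV[R]_n) : 0 <= (u *m g i y *m u^T) 0 0 by exact: metric_ge0.
have H := posdef_cauchy_schwarz (y - x0) v (riemannian_sym rg iy) (metric_unit rg iy) pos.
apply: le_trans H _.
by apply: ler_piMl; [exact: metric_ge0|exact: ball_dual].
Qed.

Lemma bump_increment gamma (a b : R) : a <= b -> C1_curve_on A gamma a b ->
  (`|bump (gamma b) - bump (gamma a)|%:E <= curve_length g gamma a b)%E.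
Proof.
move=> ab [e e0 C1].
have C1t t : a <= t <= b -> C1_curve_at A gamma t.
  by move=> /andP[at_ tb]; apply: C1; lra.
pose c s := chart i (gamma s).
pose form s := - (Num.max 0 (rho (c s)) * ((c s - x0) *m (derive1 c s)^T) 0 0) / r ^+ 2.
(* The derivative of [bump] along the curve, extended by zero like [bump] itself. *)
pose G s := if pselect (dom i (gamma s)) then form s else 0.
apply: (abs_increment_le_integral (F := bump \o gamma) (G := G)) => // t tab; last first.
  rewrite /G; case: pselect => [it|nit]; last by rewrite normr0 speed_ge0.
  rewrite (speedE (C1t t tab) it); apply: bump_derivative_bound.
  by exists (gamma t).
have [cg C1i] := C1t t tab.
have [it|nit] := pselect (dom i (gamma t)).
  have near_dom := dom_near cg it.
  have [dct cct] := C1i i it.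
  split.
    apply: (near_eq_is_derive (f := fun s => Num.max 0 (rho (c s)) ^+ 2 / (4 * r ^+ 2))).
      by apply: filterS near_dom => s si; rewrite /= /bump; case: pselect.
    rewrite /G; case: pselect => [_|//] /=; apply: is_derive_bump_formula.
    by split; [exact: dct|exact/esym/derive1E].
  apply: (near_eq_continuous (f := form)).
    by apply: filterS near_dom => s si; rewrite /G; case: pselect.
  have cc : {for t, continuous c}.
    have /derivable1_diffP/differentiable_continuous := dct; exact.
  have ck k : {for t, continuous (fun s => c s 0 k - x0 0 k)}.
    by apply: continuousB; [exact: continuous_coord_row|exact: cst_continuous].
  have crho : {for t, continuous (fun s => rho (c s))}.
    apply: continuousB; first exact: cst_continuous.
    by apply: continuous_sum => k; exact: (continuousM (ck k) (ck k)).
  have cw : {for t, continuous (fun s => ((c s - x0) *m (derive1 c s)^T) 0 0)}.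
    have -> : (fun s => ((c s - x0) *m (derive1 c s)^T) 0 0) =
        (fun s => \sum_k (c s 0 k - x0 0 k) * derive1 c s 0 k).
      by apply/funext => s; rewrite mxE; apply: eq_bigr => k _; rewrite !mxE.
    apply: continuous_sum => k; apply: continuousM => //.
    exact: continuous_coord_row cct.
  apply: continuousM; last exact: cst_continuous.
  apply: continuousN; apply: continuousM => //.
  by apply: continuous_max => //; exact: cst_continuous.
(* The curve is now outside the chart domain, hence outside the closed set [K]; it stays so for
   nearby times, at which both [bump] and [G] vanish. *)
pose K := chart_inv i @` [set y | `|y - x0| <= r].
have near_out : \forall s \near t, (~` K) (gamma s).
  apply: cg; apply: open_nbhs_nbhs; split.
    by apply: closed_openC; exact: closed_ball_chart.
  by move=> [y /ball_image yi ty]; apply: nit; rewrite -ty; exact: dom_chart_inv.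
have out0 s : (~` K) (gamma s) ->
    bump (gamma s) = 0 /\ G s = 0.
  move=> ns; rewrite /bump /G; case: pselect => //= si; rewrite /form max_l.
    by rewrite expr0n /= !mul0r oppr0 mul0r.
  exact: bump_outside.
have Gt0 : G t = 0 by exact: (out0 _ (nbhs_singleton near_out)).2.
split.
  apply: (near_eq_is_derive (f := cst 0)).
    by apply: filterS near_out => s /out0[/= -> _].
  by rewrite Gt0; exact: is_derive_cst.
apply: (near_eq_continuous (f := cst 0)); last exact: cst_continuous.
by apply: filterS near_out => s /out0[_ ->].
Qed.

Lemma bump_joined p q L : joined g p q L -> (`|bump q - bump p|%:E <= L)%E.
Proof.
elim=> [|{}L gamma a b ab c1 _ IH]; first by rewrite subrr normr0.
have H := bump_increment ab c1.
apply: le_trans (leeD IH H); rewrite -EFinD lee_fin.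
by apply: le_trans (ler_distD (bump (gamma a)) _ _) _; rewrite addrC.
Qed.

Lemma dist_lt_chart p : (riemannian_distance g p (chart_inv i x0) < (r ^+ 2 / 4)%:E)%E ->
  dom i p /\ `|chart i p - x0| <= r.
Proof.
move=> /dist_lt_joined[L J Lr].
have x0i : chart_image i x0 by apply: ball_image; rewrite subrr normr0 ltW.
(* At the centre [rho] is r^2, which explains the threshold r^2 / 4 = r^4 / (4 r^2). *)
have b0 : bump (chart_inv i x0) = r ^+ 2 / 4.
  rewrite /bump; case: pselect => [_|/(_ (dom_chart_inv x0i)) //] /=.
  rewrite chart_invK // /rho big1 ?subr0 => [|k _]; last by rewrite subrr expr0n.
  rewrite max_r ?sqr_ge0 //; field; by rewrite gt_eqF.
have := le_lt_trans (bump_joined J) Lr; rewrite b0 lte_fin.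
rewrite /bump; case: pselect => [ip /=|nip /=]; last first.
  by rewrite subr0 ger0_norm ?ltxx // divr_ge0 ?sqr_ge0.
case: (ltrP 0 (rho (chart i p))) => [/rho_gt0 //|rle].
by rewrite expr0n mul0r subr0 ger0_norm ?ltxx // divr_ge0 ?sqr_ge0.
Qed.

End Bump.
End Distance.

(** * Homothetic fields of complete metrics *)

Section Ekeland.
Context {R : realType} {T : Type} (d : T -> T -> \bar R) (phi psi : T -> R).
Hypothesis d_ge0 : forall p q, (0 <= d p q)%E.
Hypothesis d_refl : forall p, (d p p <= 0)%E.
Hypothesis d_triangle : forall p q r (a b : R),
  (d p q <= a%:E)%E -> (d q r <= b%:E)%E -> (d p r <= (a + b)%:E)%E.
Hypothesis d_complete : forall u : nat -> T,
  (forall e : R, 0 < e -> exists N : nat, forall m k : nat,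
     (N <= m)%N -> (N <= k)%N -> (d (u m) (u k) < e%:E)%E) ->
  exists p, forall e : R, 0 < e -> exists N : nat, forall m : nat,
     (N <= m)%N -> (d (u m) p < e%:E)%E.
(** Besides the continuity of [phi] and [psi], its first clause controls the distance with exchanged
    arguments, in place of symmetry of [d]. *)
Hypothesis d_continuous : forall p (e : R), 0 < e -> exists2 r : R, 0 < r &
  forall q, (d q p < r%:E)%E ->
    [/\ (d p q <= e%:E)%E, `|phi q - phi p| <= e & `|psi q - psi p| <= e].
Hypothesis phi_ge0 : forall p, 0 <= phi p.

(** Ekeland's order: moving from p to q must be paid for by a decrease of [phi]. The distance is
    bounded in both orders of its arguments, and the constraint on [psi] survives limits. *)
Let rel p q := [/\ (d p q <= (phi p - phi q)%:E)%E, (d q p <= (phi p - phi q)%:E)%E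
  & psi p <= psi q].

Let rel_phi p q : rel p q -> phi q <= phi p.
Proof. by move=> [+ _ _]; move=> /(le_trans (d_ge0 p q)); rewrite lee_fin subr_ge0. Qed.

Let rel_refl p : rel p p.
Proof. by split; rewrite ?subrr. Qed.

Let rel_trans p q r : rel p q -> rel q r -> rel p r.
Proof.
move=> [a1 a2 a3] [b1 b2 b3]; split; last exact: le_trans b3.
  by have := d_triangle a1 b1; rewrite addrA subrK.
by have := d_triangle b2 a2; rewrite addrC addrA subrK.
Qed.

(* Ekeland's variational principle for the distance d, restricted to the set where
   psi does not decrease. *)
Lemma ekeland_constrained p0 : exists2 q, psi p0 <= psi q &
  forall y, (d q y <= (phi q - phi y)%:E)%E -> (d y q <= (phi q - phi y)%:E)%E ->
    psi q <= psi y -> phi q <= phi y.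
Proof.
pose S p := [set phi y | y in rel p].
have S0 p : S p !=set0 by exists (phi p); exists p.
have Slb p : has_inf (S p) by split=> //; exists 0 => _ [y _ <-].
(* Each step covers at least half of the possible decrease of [phi]; the infimum itself need not be
   attained. *)
have /choice[step stepP] : forall p, exists q, rel p q /\ phi q <= (phi p + inf (S p)) / 2.
  move=> p; have infp : inf (S p) <= phi p by apply: ge_inf; [case: (Slb p)|exists p].
  have [E|ne] := eqVneq (inf (S p)) (phi p); first by exists p; rewrite E; split=> //; lra.
  have e0 : 0 < (phi p - inf (S p)) / 2 by rewrite divr_gt0 // subr_gt0 lt_neqAle ne.
  have [_ [q pq <-] qlt] := inf_adherent e0 (Slb p).
  by exists q; split=> //; lra.
pose u k := iter k step p0.
have uS k : u k.+1 = step (u k) by [].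
have urel m k : (m <= k)%N -> rel (u m) (u k).
  elim: k => [|k IHk]; first by rewrite leqn0 => /eqP ->.
  rewrite leq_eqVlt => /predU1P[-> //|]; rewrite ltnS => /IHk H.
  by apply: rel_trans H _; rewrite uS; case: (stepP (u k)).
have infu : has_inf (range (phi \o u)).
  by split; [exists (phi (u 0%N)); exists 0%N|exists 0 => _ [k _ <-] /=].
(* Along the sequence [phi] decreases and is bounded below, and its variation dominates the
   distances. *)
have cauchy e : 0 < e -> exists N : nat, forall m k : nat, (N <= m)%N -> (N <= k)%N ->
    (d (u m) (u k) < e%:E)%E.
  move=> e0; have [_ [N _ <-] /= Ne] := inf_adherent e0 infu.
  have lbu k : inf (range (phi \o u)) <= phi (u k).
    by apply: ge_inf; [case: infu|exists k].
  exists N => m k Nm Nk.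
  have Nm' := rel_phi (urel _ _ Nm); have Nk' := rel_phi (urel _ _ Nk).
  have lm := lbu m; have lk := lbu k.
  have [mk|/ltnW km] := leqP m k.
    have [+ _ _] := urel _ _ mk; move=> /le_lt_trans; apply; rewrite lte_fin; lra.
  have [_ + _] := urel _ _ km; move=> /le_lt_trans; apply; rewrite lte_fin; lra.
have [q uq] := d_complete cauchy.
have lim_u e : 0 < e -> exists N : nat, forall m, (N <= m)%N ->
    [/\ (d (u m) q <= e%:E)%E, (d q (u m) <= e%:E)%E, `|phi (u m) - phi q| <= e
      & `|psi (u m) - psi q| <= e].
  move=> e0; have [r r0 rP] := d_continuous q e0.
  have m0 : 0 < Num.min r e by rewrite lt_min r0.
  have [N NP] := uq _ m0; exists N => m Nm.
  have H := NP m Nm; have [|h1 h2 h3] := rP (u m).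
    by apply: lt_le_trans H _; rewrite lee_fin ge_min lexx.
  split=> //; apply: ltW; apply: lt_le_trans H _.
  by rewrite lee_fin ge_min lexx orbT.
have relq k : rel (u k) q.
  have H e : 0 < e -> exists m, [/\ rel (u k) (u m), (d (u m) q <= e%:E)%E,
      (d q (u m) <= e%:E)%E, `|phi (u m) - phi q| <= e & `|psi (u m) - psi q| <= e].
    move=> e0; have [N NP] := lim_u e e0; exists (maxn N k).
    have [a b c f] := NP (maxn N k) (leq_maxl _ _).
    by split=> //; apply: urel; exact: leq_maxr.
  split.
  - apply/lee_addgt0Pr => e e0; have e2 : 0 < e / 2 by rewrite divr_gt0.
    have [m [[r1 r2 r3] h1 h2 + h4]] := H _ e2; rewrite ler_norml => /andP[h31 h32].
    apply: le_trans (d_triangle r1 h1) _; rewrite -EFinD lee_fin; lra.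
  - apply/lee_addgt0Pr => e e0; have e2 : 0 < e / 2 by rewrite divr_gt0.
    have [m [[r1 r2 r3] h1 h2 + h4]] := H _ e2; rewrite ler_norml => /andP[h31 h32].
    apply: le_trans (d_triangle h2 r2) _; rewrite -EFinD lee_fin; lra.
  - apply/ler_addgt0Pr => e e0.
    have [m [[r1 r2 r3] h1 h2 h3 +]] := H _ e0; rewrite ler_norml => /andP[h41 h42].
    by lra.
exists q; first by have [] := relq 0%N.
move=> y qy yq psiy; have rqy : rel q y by [].
rewrite leNgt; apply/negP => lt_yq.
(* A strictly better [y] would be reachable from every term of the sequence. Once phi (u N) exceeds
   phi q by at most half the gap, the halving rule pushes phi (u N.+1) to at most (3 phi q + phi y)
   / 4, below the limit value phi q. *)
have e0 : 0 < (phi q - phi y) / 2 by rewrite divr_gt0 // subr_gt0.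
have [N /(_ N (leqnn N))[_ _ + _]] := lim_u _ e0; rewrite ler_norml => /andP[_ h].
have [_ h1] := stepP (u N); rewrite -uS in h1.
have h2 : inf (S (u N)) <= phi y.
  by apply: ge_inf; [case: (Slb (u N))|exists y => //; exact: rel_trans rqy].
have h3 := rel_phi (relq N.+1).
clear qy yq; lra.
Qed.

End Ekeland.

Lemma is_derive_upper (R : realType) (f : R -> R) (d c : R) :
  is_derive (0 : R) 1 f d -> d < c ->
  exists2 r : R, 0 < r & forall h : R, 0 < h -> h < r -> f h <= f 0 + h * c.
Proof.
move=> [df dE] dc.
have cv : h^-1 *: (f (h *: 1 + 0) - f 0) @[h --> 0^'] --> d by rewrite -dE; exact: df.
have e0 : 0 < c - d by rewrite subr_gt0.
have /(@cvgrPdist_le _ _ _ _ _ _ _) /(_ _ e0) := cv.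
rewrite near_withinE => /near_realP[r r0 rP]; exists r => // h h0 hr.
have := rP h; rewrite subr0 gtr0_norm // => /(_ hr); rewrite gt_eqF //= => /(_ isT).
rewrite [h *: 1]mulr1 addr0 ler_norml => /andP[H _].
have : h^-1 * (f h - f 0) <= c by move: H; rewrite /GRing.scale /=; lra.
by rewrite ler_pdivrMl // lerBlDl.
Qed.

Lemma sqrtr_le (R : realType) (x e : R) : 0 <= e -> x <= e ^+ 2 -> Num.sqrt x <= e.
Proof. by move=> e0 xe; rewrite -(ger0_norm e0) -sqrtr_sqr ler_wsqrtr. Qed.

(** Since sqrt (1 - u) <= 1 - u / 2, the square root falls by at least the fraction h c / 4; the
    factor 8 / c converts this into 2 h sqrt N, the length later allowed for the step. Nonnegativity
    of N' forces h c <= 2, so that 1 - h c / 4 is nonnegative. *)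
Lemma sqrtr_decrease (R : realType) (N N' h c : R) :
  0 < N -> 0 <= N' -> 0 < h -> 0 < c -> N' <= N - h * c / 2 * N ->
  2 * h * Num.sqrt N <= 8 / c * Num.sqrt N - 8 / c * Num.sqrt N'.
Proof.
move=> N0 N'0 h0 c0 N'N; have a0 : 0 < Num.sqrt N by rewrite sqrtr_gt0.
have aE : Num.sqrt N ^+ 2 = N by rewrite sqr_sqrtr // ltW.
have hc : h * c <= 2.
  have : 0 <= N * (1 - h * c / 2) by apply: le_trans N'0 _; lra.
  by rewrite pmulr_rge0 //; lra.
have H : Num.sqrt N' <= Num.sqrt N * (1 - h * c / 4).
  apply: sqrtr_le; first by apply: mulr_ge0; [exact: ltW|lra].
  apply: le_trans N'N _; rewrite exprMn aE.
  have : 0 <= N * (h * c) ^+ 2 by rewrite mulr_ge0 ?sqr_ge0 // ltW.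
  by rewrite !expr2; lra.
have c8 : 0 <= 8 / c by rewrite divr_ge0 // ltW.
have -> : 2 * h * Num.sqrt N = 8 / c * (Num.sqrt N * (h * c / 4)).
  by field; rewrite gt_eqF.
by rewrite -mulrBr; apply: ler_wpM2l => //; lra.
Qed.

Lemma onem_oo (R : realType) (t : R) : -1 < t -> t < 2 -> -1 < 1 - t /\ 1 - t < 2.
Proof. by move=> *; split; lra. Qed.

Lemma onem_cc (R : realType) (t : R) : 0 <= t <= 1 -> 0 <= 1 - t <= 1.
Proof. by move=> /andP[t0 t1]; apply/andP; split; lra. Qed.

Lemma quadratic_form_le (R : realType) n (G : 'M[R]_n) (v : 'rV[R]_n) :
  (v *m G *m v^T) 0 0 <= `|v| ^+ 2 * \sum_a \sum_b `|G a b|.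
Proof.
rewrite mxE mulr_sumr; under eq_bigr do rewrite mxE mulr_suml.
rewrite exchange_big; apply: ler_sum => a _; rewrite mulr_sumr; apply: ler_sum => b _.
apply: le_trans (ler_norm _) _; rewrite !normrM mxE mulrAC expr2.
apply: ler_wpM2r => //; apply: ler_pM => //; exact: ler_coord_norm.
Qed.

(** W (g(W, W)) = (L_W g)(W, W) + 2 g([W, W], W), and the bracket vanishes. *)
Lemma dir_norm2 (R : realType) n (U : set 'rV[R]_n) (W : 'rV[R]_n -> 'rV[R]_n)
    (g : 'rV[R]_n -> 'M[R]_n) (s : R) x :
  smooth_mx U W -> smooth_mx U g -> U x -> lie W g x = s *: g x ->
  dir W (fun y => (W y *m g y *m (W y)^T) 0 0) x = s * (W x *m g x *m (W x)^T) 0 0.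
Proof.
move=> sW sg Ux E; have dW := smooth_mxderivable sW Ux.
have dg := smooth_mxderivable sg Ux.
have DW : dirmx W W x = W x *m jac W x.
  apply/matrixP => i b; rewrite !ord1 dirmxE [RHS]mxE.
  by apply: eq_bigr => k _; rewrite jacE.
have Dg : dirmx W g x = s *: g x - jac W x *m g x - g x *m (jac W x)^T.
  by rewrite -E /lie [_ + _ + _ - _]addrAC !addrK.
rewrite -(dirmxE W (fun y => W y *m g y *m (W y)^T)).
rewrite (dirmxM _ (mxderivableM dW dg) (mxderivableT dW)) (dirmxM _ dW dg) dirmxT DW Dg.
have -> : s * (W x *m g x *m (W x)^T) 0 0 = (s *: (W x *m g x *m (W x)^T)) 0 0 by rewrite [RHS]mxE.
congr (fun_of_matrix _ 0 0); rewrite trmx_mul.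
by move: (W x) (g x) (jac W x) => w G B; mx_ring.
Qed.

Section Homothety.
Context {R : realType} {n : nat} {M : topologicalType}.
Variable A : smooth_atlas R n M.
Implicit Types (i j : chart_index A).
Variables (g : tensor_components A) (rg : riemannian_metric g).
Hypothesis M_hausdorff : hausdorff_space M.

Lemma near_chart i x0 : chart_image i x0 ->
  exists2 r : R, 0 < r & forall y, `|y - x0| < r -> chart_image i y.
Proof.
by move=> ix; apply/near_rowP; apply: open_nbhs_nbhs; split=> //; exact: open_chart_image.
Qed.

Lemma dist_near i x0 (e : R) : chart_image i x0 -> 0 < e ->
  exists2 r : R, 0 < r & forall y, `|y - x0| < r ->
    (riemannian_distance g (chart_inv i x0) (chart_inv i y) <= e%:E)%E.
Proof.
move=> ix e0; have [r1 r10 r1P] := near_chart ix.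
pose Q y : R := \sum_a \sum_b `|g i y a b|.
have cQ : {for x0, continuous Q}.
  apply: continuous_sum => a; apply: continuous_sum => b.
  apply: (@continuous_comp _ _ _ (fun y => g i y a b) (fun u : R => `|u|)).
    exact: (smooth_continuous (metric_smooth rg i a b) ix).
  exact: norm_continuous.
pose B : R := Q x0 + 1.
have Q0 : 0 <= Q x0 by apply: sumr_ge0 => a _; exact: sumr_ge0.
have /cvg_rowP /(_ 1 ltr01)[r2 r20 r2P] := cQ.
(* Halving keeps t (y - x0) in the good ball for |t| <= 2, as [dist_segment] wants; e / (1 + B)
   makes the squared speed at most e^2 B / (1 + B)^2 <= e^2, where B bounds the entries of g
   nearby. *)
pose r := Num.min (Num.min r1 r2 / 2) (e / (1 + B)).
have B0 : 0 <= B by rewrite /B; lra.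
have r0 : 0 < r by rewrite /r !lt_min !divr_gt0 ?lt_min ?r10 ?r20 //; lra.
exists r => // y; rewrite /r lt_min => /andP[yr ye].
have inball t : -1 < t -> t < 2 -> `|t *: (y - x0) + x0 - x0| < Num.min r1 r2.
  move=> t1 t2; rewrite addrK normrZ.
  have : `|t| <= 2 by rewrite ler_norml; apply/andP; split; lra.
  have := normr_ge0 (y - x0); move: yr; rewrite ltr_pdivlMr //.
  by move=> h1 h2 h3; apply: le_lt_trans h1; rewrite mulrC ler_wpM2l.
have -> : chart_inv i y = chart_inv i ((y - x0) + x0) by rewrite subrK.
apply: (dist_segment rg) => [t t1 t2|t /andP[t0 t1]].
  by apply: r1P; apply: lt_le_trans (inball t t1 t2) _; rewrite ge_min lexx.
apply: sqrtr_le; first exact: ltW.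
apply: le_trans (quadratic_form_le _ _) _.
have QB : Q (t *: (y - x0) + x0) <= B.
  have /r2P : `|t *: (y - x0) + x0 - x0| < r2.
    apply: lt_le_trans (inball t _ _) _; [lra|lra|by rewrite ge_min lexx orbT].
  by rewrite -/(Q _) ler_norml /B => /andP[h _]; lra.
rewrite -/(Q _); apply: le_trans (ler_wpM2l (sqr_ge0 _) QB) _.
have h : `|y - x0| ^+ 2 <= (e / (1 + B)) ^+ 2.
  by rewrite ler_pXn2r ?nnegrE ?(ltW ye) // divr_ge0 ?(ltW e0) //; lra.
apply: le_trans (ler_wpM2r B0 h) _.
have B1 : 0 < 1 + B by lra.
rewrite expr_div_n mulrAC ler_pdivrMr ?exprn_gt0 //.
by apply: ler_wpM2l; [exact: sqr_ge0|nra].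
Qed.

(** The converse comparison to [dist_near], from distance to coordinates. The dual norm of y - x0
    tends to 0 at the centre, so small balls satisfy the hypotheses of the bump function. *)
Lemma dist_cvg_chart i p (e : R) : dom i p -> 0 < e ->
  exists2 r : R, 0 < r & forall q, (riemannian_distance g q p < r%:E)%E ->
    dom i q /\ `|chart i q - chart i p| <= e.
Proof.
move=> ip e0; pose x0 := chart i p; have ix : chart_image i x0 by exists p.
have [r1 r10 r1P] := near_chart ix.
pose Q y := ((y - x0) *m invmx (g i y) *m (y - x0)^T) 0 0.
have cQ : {for x0, continuous Q}.
  have cc k : {for x0, continuous (fun y : 'rV[R]_n => y 0 k - x0 0 k)}.
    apply: continuousB; last exact: cst_continuous.
    exact: (@coord_continuous R 1 n 0 k x0).
  have cg a b : {for x0, continuous (fun y => invmx (g i y) a b)}.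
    apply: smooth_continuous ix; apply: smooth_invmx; first exact: open_chart_image.
      exact: metric_smooth.
    exact: metric_unit.
  have -> : Q = fun y => \sum_b (\sum_a (y 0 a - x0 0 a) * invmx (g i y) a b) * (y 0 b - x0 0 b).
    apply/funext => y; rewrite /Q mxE; apply: eq_bigr => b _; rewrite !mxE.
    by congr (_ * _); apply: eq_bigr => a _; rewrite !mxE.
  apply: continuous_sum => b; apply: continuousM => //.
  by apply: continuous_sum => a; exact: continuousM.
have Q0 : Q x0 = 0 by rewrite /Q subrr !mul0mx mxE.
have /cvg_rowP /(_ 1 ltr01)[r2 r20 r2P] := cQ.
pose r := Num.min (Num.min r1 r2 / 2) e.
have m0 : 0 < Num.min r1 r2 by rewrite lt_min r10.
have r0 : 0 < r by rewrite lt_min e0 divr_gt0.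
have rlt y : `|y - x0| <= r -> `|y - x0| < r1 /\ `|y - x0| < r2.
  rewrite le_min => /andP[h _]; apply/andP; rewrite -lt_min.
  apply: le_lt_trans h _; rewrite ltr_pdivrMr // ltr_pMr // ltr1n //.
have b1 y : `|y - x0| <= r -> chart_image i y by move=> /rlt[+ _]; exact: r1P.
have b2 y : `|y - x0| <= r -> ((y - x0) *m invmx (g i y) *m (y - x0)^T) 0 0 <= 1.
  by move=> /rlt[_ /r2P]; rewrite Q0 sub0r normrN => /(le_trans (ler_norm _)).
exists (r ^+ 2 / 4); first by rewrite divr_gt0 // exprn_gt0.
move=> q; have -> : p = chart_inv i x0 by rewrite /x0 chartK.
move=> /(dist_lt_chart rg M_hausdorff r0 b1 b2)[iq h]; split=> //.
rewrite /x0 chartK // -/x0.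
by apply: le_trans h _; rewrite ge_min lexx orbT.
Qed.

Section Vanishing.
Hypothesis g_complete : complete_metric g.
Variables (W : vector_components A) (s : R).
Hypothesis sW : smooth_vector_field W.
Hypothesis lieW : forall i x, chart_image i x -> lie (W i) (g i) x = s *: g i x.
Hypothesis s_neq0 : s != 0.
Hypothesis scal_transition : forall i j x, overlap i j x ->
  scal (g i) x = scal (g j) (transition i j x).

Definition norm2 i x : R := (W i x *m g i x *m (W i x)^T) 0 0.

Lemma norm2_transition i j x : overlap i j x -> norm2 i x = norm2 j (transition i j x).
Proof.
by move=> ijx; rewrite /norm2 (norm_transition rg _ ijx) (field_transition sW ijx).
Qed.

Lemma norm2_ge0 i x : chart_image i x -> 0 <= norm2 i x.
Proof. exact: metric_ge0. Qed.

Lemma smooth_norm2 i : smooth_on (chart_image i) (norm2 i).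
Proof.
have sWi := smooth_field i sW.
exact: (smooth_mxM (@open_chart_image _ _ _ A i)
  (smooth_mxM (@open_chart_image _ _ _ A i) sWi (metric_smooth rg i)) (smooth_mxT sWi) 0 0).
Qed.

(* Moving along W if s < 0 and along - W if s > 0, the norm of W decreases and the
   scalar curvature grows. *)
Lemma contracting_step i x : chart_image i x -> scal (g i) x != 0 ->
  exists2 v : 'rV[R]_n,
    [/\ forall t : R, -1 < t -> t < 2 -> chart_image i (t *: v + x),
        scal (g i) x ^+ 2 <= scal (g i) (v + x) ^+ 2 &
        0 < norm2 i x] &
    exists2 h : R, 0 < h &
      norm2 i (v + x) <= norm2 i x - h * `|s| / 2 * norm2 i x /\
      forall t : R, 0 <= t <= 1 ->
        (v *m g i (t *: v + x) *m v^T) 0 0 <= (2 * h) ^+ 2 * norm2 i x.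
Proof.
move=> ix S0; pose N0 := norm2 i x; pose w := W i x.
have openi := @open_chart_image _ _ _ A i.
have DS : dir (W i) (scal (g i)) x = - s * scal (g i) x.
  exact: (dir_scalar_curvature rg (smooth_field i sW) (@lieW i) ix).
have w0 : w != 0.
  apply: contra_neq S0 => w0; move/eqP: DS.
  rewrite /dir big1 => [|k _]; last by rewrite -/w w0 mxE mul0r.
  by rewrite eq_sym mulf_eq0 oppr_eq0 (negbTE s_neq0) => /eqP.
have N0gt : 0 < N0 by exact: (metric_pos rg ix).
(* The direction in which g contracts: along it |W|^2 has derivative - |s| |W|^2 and S^2 has
   derivative 2 |s| S^2. *)
pose v := - Num.sg s *: w.
have sgs : Num.sg s * s = `|s| by rewrite normrEsg.
have line f : smooth_on (chart_image i) f ->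
    is_derive (0 : R) 1 (fun t : R => f (t *: v + x)) (- Num.sg s * dir (W i) f x).
  move=> sf; have cx : chart_image i (0 *: v + x) by rewrite scale0r add0r.
  have [d E] := smooth_is_derive_comp openi sf cx (is_derive_affine x v 0).
  split; first exact: d.
  rewrite [LHS]E scale0r add0r mulr_sumr; apply: eq_bigr => k _.
  by rewrite mxE mulrA.
have vE : v = - Num.sg s *: w by [].
clearbody v.
have sS := smooth_scalar_curvature rg i.
have DN : dir (W i) (norm2 i) x = s * N0.
  exact: (dir_norm2 (smooth_field i sW) (metric_smooth rg i) ix (lieW ix)).
have DS2 : dir (W i) (fun y => - (scal (g i) y * scal (g i) y)) x = 2 * s * scal (g i) x ^+ 2.
  have dS k : derivable (scal (g i)) x (delta_mx 0 k) by exact: smooth_derivable sS ix.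
  transitivity (- (2 * scal (g i) x) * dir (W i) (scal (g i)) x).
    rewrite /dir mulr_sumr; apply: eq_bigr => k _.
    rewrite (partialN (derivableM (dS k) (dS k))) (partialM (dS k) (dS k)).
    by ring.
  by rewrite DS; ring.
have sS2 : smooth_on (chart_image i) (fun y => - (scal (g i) y * scal (g i) y)).
  exact: smoothN (smoothM openi sS sS).
have s_gt0 : 0 < `|s| by rewrite normr_gt0.
have S2_gt0 : 0 < scal (g i) x ^+ 2 by rewrite exprn_even_gt0.
have x0E : 0 *: v + x = x by rewrite scale0r add0r.
have [r1 r10 r1P] : exists2 r : R, 0 < r & forall h, `|h - 0| < r -> chart_image i (h *: v + x).
  by apply/near_realP; apply: near_affine; rewrite ?x0E.
(* Half of the true slope - |s| N0, leaving strict room for the first-order error of a finite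
   step. *)
have [|r2 r20 r2P] := is_derive_upper (c := - (`|s| / 2 * N0)) (line _ (smooth_norm2 i)).
  by rewrite DN mulrA mulNr sgs mulNr ltrN2 ltr_pM2r //; lra.
(* Upper estimates are what [is_derive_upper] gives, hence the minus sign in front of S^2; its slope
   is negative since S is nonzero at x. *)
have [|r3 r30 r3P] := is_derive_upper (c := 0) (line _ sS2).
  rewrite DS2; have -> : - Num.sg s * (2 * s * scal (g i) x ^+ 2) = - (2 * `|s| * scal (g i) x ^+ 2).
    by rewrite -sgs; ring.
  by rewrite oppr_lt0; apply: mulr_gt0 => //; apply: mulr_gt0.
pose q y : R := (w *m g i y *m w^T) 0 0.
have cq : {for (0 : R), continuous (fun h : R => q (h *: v + x))}.
  apply: (@continuous_comp _ _ _ (fun h : R => h *: v + x) q); first exact: continuous_affine.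
  rewrite x0E; apply: smooth_continuous ix.
  have sw : smooth_mx (chart_image i) (fun=> w) by move=> a b; exact: smooth_cst.
  have swT : smooth_mx (chart_image i) (fun=> w^T) by move=> a b; exact: smooth_cst.
  exact: (smooth_mxM openi (smooth_mxM openi sw (metric_smooth rg i)) swT 0 0).
(* By continuity the g-norm of the constant vector [w] at most doubles along the step; this is the 2
   in the length bound 2 h |W|. *)
have [r4 r40 r4P] : exists2 r : R, 0 < r & forall h, `|h - 0| < r -> q (h *: v + x) <= 4 * N0.
  apply/near_realP; have e0 : 0 < 3 * N0 by rewrite mulr_gt0.
  have /cvgrPdist_le /(_ _ e0) := cq; apply: filterS => h.
  rewrite x0E -/(norm2 i x) ler_norml => /andP[+ _].
  by rewrite -[q x]/N0; lra.
pose r := Num.min (Num.min r1 r2) (Num.min r3 r4).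
have rgt : 0 < r by rewrite /r !lt_min r10 r20 r30 r40.
(* Any h with 2 h < r would do: parameters up to 2 in absolute value then stay within all four
   radii. *)
pose h := r / 3.
have h0 : 0 < h by rewrite divr_gt0.
have h2r : 2 * h < r by rewrite /h; lra.
have [[hr1 hr2] [hr3 hr4]] : (2 * h < r1 /\ 2 * h < r2) /\ (2 * h < r3 /\ 2 * h < r4).
  by move: h2r; rewrite /r !lt_min => /andP[/andP[-> ->] /andP[-> ->]].
exists (h *: v).
  split; last exact: N0gt.
  - move=> t t1 t2; rewrite scalerA; apply: r1P; rewrite subr0 normrM (gtr0_norm h0).
    apply: le_lt_trans hr1; rewrite ler_pM2r // ler_norml; apply/andP; split; lra.
  - have := r3P h h0; rewrite mulr0 addr0 x0E lerN2 !expr2; apply; lra.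
exists h => //; split.
  have hlt : h < r2 by lra.
  by apply: le_trans (r2P h h0 hlt) _; rewrite x0E -/N0; lra.
move=> t /andP[t0 t1]; rewrite scalerA.
have -> : ((h *: v) *m g i ((t * h) *: v + x) *m (h *: v)^T) 0 0 = h ^+ 2 * q ((t * h) *: v + x).
  have E a : ((a *: w) *m g i ((t * h) *: v + x) *m (a *: w)^T) 0 0 = a ^+ 2 * q ((t * h) *: v + x).
    by rewrite linearZ /= -!scalemxAl -scalemxAr scalerA [LHS]mxE expr2.
  have hv : h *: v = (h * - Num.sg s) *: w by rewrite vE scalerA.
  by rewrite hv E exprMn sqrrN sqr_sg s_neq0 mulr1.
have /r4P H : `|t * h - 0| < r4.
  rewrite subr0 normrM (gtr0_norm h0) ger0_norm //; apply: le_lt_trans hr4.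
  by rewrite ler_pM2r //; lra.
have -> : (2 * h) ^+ 2 * norm2 i x = h ^+ 2 * (4 * N0) by rewrite /N0; ring.
by rewrite ler_pM2l // exprn_gt0.
Qed.

Definition at_point (f : chart_index A -> 'rV[R]_n -> R) (p : M) : R :=
  f (chart_at A p) (chart (chart_at A p) p).

Lemma at_pointE f i p : (forall i j x, overlap i j x -> f i x = f j (transition i j x)) ->
  dom i p -> at_point f p = f i (chart i p).
Proof.
move=> ft ip; have jp := dom_chart_at A p.
by rewrite /at_point (ft _ _ _ (overlap_chart jp ip)) /transition chartK.
Qed.

(* Along W the norm of W decays at the rate |s| / 2, so the flow line has length at most
   2 |W| / |s|; the larger factor 8 leaves room for the error of a single finite step. *)
Let phi p : R := 8 / `|s| * Num.sqrt (at_point norm2 p).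
Let psi p : R := at_point (fun i => scal (g i)) p ^+ 2.

(** Supplies the continuity hypothesis of [ekeland_constrained]: smallness of d(q, p) gives
    closeness in a chart, whence the bounds on [phi] and [psi], and a chart segment bounds d(p,
    q). *)
Lemma potential_continuous p (e : R) : 0 < e -> exists2 r : R, 0 < r &
  forall q, (riemannian_distance g q p < r%:E)%E ->
    [/\ (riemannian_distance g p q <= e%:E)%E, `|phi q - phi p| <= e & `|psi q - psi p| <= e].
Proof.
move=> e0; pose i := chart_at A p; have ip : dom i p by exact: dom_chart_at.
pose x0 := chart i p; have ix : chart_image i x0 by exists p.
have [r1 r10 r1P] := dist_near ix e0.
have c1 : {for x0, continuous (fun y => 8 / `|s| * Num.sqrt (norm2 i y))}.
  apply: continuousM; first exact: cst_continuous.
  apply: (@continuous_comp _ _ _ (norm2 i) Num.sqrt); last exact: sqrt_continuous.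
  exact: smooth_continuous (smooth_norm2 i) ix.
have c2 : {for x0, continuous (fun y => scal (g i) y ^+ 2)}.
  have c := smooth_continuous (smooth_scalar_curvature rg i) ix.
  exact: (continuousM c c).
have /cvg_rowP /(_ e e0)[r2 r20 r2P] := c1.
have /cvg_rowP /(_ e e0)[r3 r30 r3P] := c2.
pose r := Num.min r1 (Num.min r2 r3) / 2.
have m0 : 0 < Num.min r1 (Num.min r2 r3) by rewrite !lt_min r10 r20.
have r0 : 0 < r by rewrite divr_gt0.
have [d d0 dP] := dist_cvg_chart ip r0.
exists d => // q /dP[iq qr].
have : `|chart i q - chart i p| < Num.min r1 (Num.min r2 r3).
  by apply: le_lt_trans qr _; rewrite ltr_pdivrMr // ltr_pMr // ltr1n.
rewrite !lt_min => /and3P[q1 q2 q3]; split.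
- by have := r1P _ q1; rewrite !chartK.
- by rewrite distrC /phi (at_pointE norm2_transition iq) (at_pointE norm2_transition ip); exact: r2P.
- by rewrite distrC /psi (at_pointE scal_transition iq) (at_pointE scal_transition ip); exact: r3P.
Qed.

(** The Ekeland point keeps S nonzero because [psi] has not decreased. A contracting step from it
    has length at most 2 h |W| and lowers [phi] by at least as much, against minimality. *)
Theorem homothetic_scal_eq0 i x : chart_image i x -> scal (g i) x = 0.
Proof.
move=> [p ip <-]; apply/eqP/negPn/negP => Sp.
have phi0 q : 0 <= phi q by rewrite mulr_ge0 ?sqrtr_ge0 ?divr_ge0.
have d0 q q' : (0 <= riemannian_distance g q q')%E.
  by apply: le_ereal_inf_tmp => L; exact: joined_ge0.
have [q psi_q qmax] := ekeland_constrained d0 (dist_refl g) (@dist_triangle _ _ _ _ g) g_complete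
  potential_continuous phi0 p.
pose j := chart_at A q; have jq : dom j q by exact: dom_chart_at.
pose y := chart j q; have jy : chart_image j y by exists q.
have Sq : scal (g j) y != 0.
  have : 0 < psi p by rewrite /psi (at_pointE scal_transition ip) exprn_even_gt0.
  by move=> /lt_le_trans/(_ psi_q); rewrite /psi (at_pointE scal_transition jq) exprn_even_gt0.
have [v [vim vS N0] [h h0 [vN vlen]]] := contracting_step jy Sq.
have s0 : 0 < `|s| by rewrite normr_gt0.
have N11 : (-1 : R) < 1 by rewrite (lt_trans (ltrN10 R)) ?ltr01.
have lt12 : (1 : R) < 2 by rewrite ltr1n.
have vy1 : chart_image j (v + y) by rewrite -[v]scale1r; exact: vim N11 lt12.
pose q' := chart_inv j (v + y); have jq' : dom j q' by exact: dom_chart_inv.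
pose N := norm2 j y; pose N' := norm2 j (v + y).
have phiq : phi q = 8 / `|s| * Num.sqrt N by rewrite /phi (at_pointE norm2_transition jq).
have phiq' : phi q' = 8 / `|s| * Num.sqrt N'.
  by rewrite /phi (at_pointE norm2_transition jq') chart_invK.
have N'0 : 0 <= N' by exact: norm2_ge0.
pose a := Num.sqrt N; have aE : a ^+ 2 = N by rewrite sqr_sqrtr // ltW.
have a0 : 0 < a by rewrite sqrtr_gt0.
have gain : 2 * h * a <= phi q - phi q'.
  by rewrite phiq phiq'; exact: sqrtr_decrease.
have len t : 0 <= t <= 1 -> Num.sqrt ((v *m g j (t *: v + y) *m v^T) 0 0) <= 2 * h * a.
  move=> t01; apply: sqrtr_le; first by rewrite mulr_ge0 ?(ltW a0) // mulr_ge0 ?(ltW h0).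
  by rewrite exprMn aE; exact: vlen.
have qE : q = chart_inv j y by rewrite /y chartK.
have dqq' : (riemannian_distance g q q' <= (phi q - phi q')%:E)%E.
  by rewrite qE; apply: le_trans (dist_segment rg vim len) _; rewrite lee_fin -qE.
(* The reversed segment, reparametrized by 1 - t, bounds the distance in the other order with the
   same length. *)
have revE t : t *: (- v) + (v + y) = (1 - t) *: v + y.
  by rewrite scalerN addrA scalerBl scale1r [- _ + _]addrC.
have dq'q : (riemannian_distance g q' q <= (phi q - phi q')%:E)%E.
  have -> : q = chart_inv j (- v + (v + y)) by rewrite addKr.
  rewrite addKr -qE.
  have H : (riemannian_distance g q' (chart_inv j (- v + (v + y))) <= (2 * h * a)%:E)%E.
    apply: (dist_segment rg) => [t t1 t2|t t01]; rewrite revE.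
      by have [? ?] := onem_oo t1 t2; exact: vim.
    have -> : (- v *m g j ((1 - t) *: v + y) *m (- v)^T) = v *m g j ((1 - t) *: v + y) *m v^T.
      by rewrite linearN /= mulmxN !mulNmx opprK.
    by apply: len; exact: onem_cc.
  by rewrite addKr -qE in H; apply: le_trans H _; rewrite lee_fin.
have psi_le : psi q <= psi q'.
  by rewrite /psi (at_pointE scal_transition jq) (at_pointE scal_transition jq') chart_invK.
have := qmax q' dqq' dq'q psi_le; apply/negP; rewrite -ltNge -subr_gt0.
by apply: lt_le_trans gain; rewrite !mulr_gt0.
Qed.

End Vanishing.
End Homothety.

Lemma dir_affine (R : realType) n (V : 'rV[R]_n -> 'rV[R]_n) (f : 'rV[R]_n -> R) (k c : R) x :
  (forall a, derivable f x (delta_mx 0 a)) ->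
  dir V (fun y => k * (f y - c)) x = k * dir V f x.
Proof.
move=> df; rewrite /dir mulr_sumr; apply: eq_bigr => a _.
have dc := derivable_cst c x (delta_mx 0 a).
have dk := derivable_cst k x (delta_mx 0 a).
rewrite (partialM dk (derivableB (df a) dc)) (partialB (df a) dc).
by rewrite [partial a (cst k) x]partial_cst [partial a (cst c) x]partial_cst mul0r add0r subr0 mulrCA.
Qed.

Lemma smooth_vector_fieldB (R : realType) n (M : topologicalType) (A : smooth_atlas R n M)
    (V W : vector_components A) :
  smooth_vector_field V -> smooth_vector_field W ->
  smooth_vector_field (fun i x => V i x - W i x).
Proof.
move=> sV sW; split=> [i a|i j x ijx].
  exact: (smooth_mxB (@open_chart_image _ _ _ A i) (smooth_field i sV) (smooth_field i sW) 0 a).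
by rewrite (field_transition sV ijx) (field_transition sW ijx) mulmxBl.
Qed.

Theorem theorem3p1 (R : realType) (n : nat) (hn : (3 <= n)%N)
  (M : topologicalType)
  (M_hausdorff : hausdorff_space M) (M_second_countable : @second_countable M)
  (A : smooth_atlas R n M) (g : tensor_components A)
  (V1 V2 : vector_components A) (c1 c2 : R)
  (soliton1 : nontrivial_soliton g V1 c1)
  (soliton2 : nontrivial_soliton g V2 c2)
  (distinct12 : distinct_solitons V1 V2 c1 c2) :
  killing_field g (lie_bracket V1 V2).
Proof.
have [[rg g_complete sV1 E1] _] := soliton1.
have [[_ _ sV2 E2] _] := soliton2.
have two_neq0 : (2 : R) != 0 by rewrite pnatr_eq0.
have n_gt0 : (0 < n)%N by exact: leq_trans hn.
have lieE V c : (forall i x, chart_image i x ->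
      lie_derivative V g i x = (2 * (scalar_curvature g i x - c)) *: g i x) ->
    forall i x, chart_image i x -> lie (V i) (g i) x = (2 * (scal (g i) x - c)) *: g i x.
  by move=> E i x ix; rewrite -lie_derivativeE E // scalar_curvatureE.
have {E1}L1 := lieE _ _ E1; have {E2}L2 := lieE _ _ E2.
have scal_transition i j x : overlap i j x -> scal (g i) x = scal (g j) (transition i j x).
  pose r i x := 2 * (scal (g i) x - c1).
  (* The scalar curvature is recovered from the conformal factor 2 (S - c1) of the first soliton,
     whose values agree on overlaps. *)
  move=> ijx; have := conformal_factor_transition rg (r := r) n_gt0 sV1 L1 ijx.
  by move=> /(mulfI two_neq0)/addIr.
pose W : vector_components A := fun i x => V1 i x - V2 i x.
have sW : smooth_vector_field W by exact: smooth_vector_fieldB.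
have LW i x : chart_image i x -> lie (W i) (g i) x = (2 * (c2 - c1)) *: g i x.
  move=> ix; rewrite [LHS](lie_sub g sV1 sV2 ix) L1 // L2 // -scalerBl.
  by congr (_ *: _); ring.
have WS i x : chart_image i x -> dir (W i) (scal (g i)) x = 0.
  move=> ix; rewrite (dir_scalar_curvature rg (smooth_field i sW) (@LW i) ix).
  (* If c1 = c2 the weight of S is zero; otherwise W is a homothetic field with nonzero factor on a
     complete manifold and S itself vanishes. *)
  have [->|c12] := eqVneq c1 c2; first by rewrite subrr mulr0 oppr0 mul0r.
  rewrite (homothetic_scal_eq0 rg M_hausdorff g_complete sW LW _ scal_transition ix) ?mulr0 //.
  by rewrite mulf_neq0 // subr_eq0 eq_sym.
split=> [|i x ix]; first exact: smooth_lie_bracket.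
rewrite lie_derivativeE.
have -> : lie_bracket V1 V2 i = bracket (V1 i) (V2 i) by apply/funext => y; exact: lie_bracketE.
have openi := @open_chart_image _ _ _ A i.
have sS := smooth_scalar_curvature rg i.
have sr c : smooth_on (chart_image i) (fun y => 2 * (scal (g i) y - c)).
  by apply: smoothM => //; [exact: smooth_cst|apply: smoothB => //; exact: smooth_cst].
rewrite (lie_bracket_conformal openi (smooth_field i sV1) (smooth_field i sV2)
  (metric_smooth rg i) (sr c1) (sr c2) (@L1 i) (@L2 i) ix).
have dS a : derivable (scal (g i)) x (delta_mx 0 a) by exact: smooth_derivable sS ix.
rewrite !dir_affine // -mulrBr.
have -> : dir (V1 i) (scal (g i)) x - dir (V2 i) (scal (g i)) x = dir (W i) (scal (g i)) x.
  have WE k : W i x 0 k = V1 i x 0 k - V2 i x 0 k by rewrite /W !mxE.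
  by rewrite /dir -sumrB; apply: eq_bigr => k _; rewrite WE mulrBl.
by rewrite WS // mulr0 scale0r.
Qed.
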